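(* Let $D$ be an integral domain and let $R$ be a pseudo-polynomial retract $D$-algebra. Let $\Theta$ be a sharp pre-Jaffard family of $D$, and suppose that $\mathrm{LPic}_u(RT,T)$ is a free abelian group for each $T\in\Theta$. Then there is an isomorphism $$\mathrm{LPic}_u(R,D)\simeq\bigoplus_{T\in\Theta}\mathrm{LPic}_u(RT,T).$$
   Context: All rings are commutative with unit; $D$ is an integral domain that is not a field, with quotient field $K\neq D$. If $A\subseteq B$ are integral domains, the quotient field of $A$ is viewed inside the quotient field of $B$. A fractional ideal of a domain $B$ is a $B$-submodule $I$ of its quotient field with $bI\subseteq B$ for some nonzero $b\in B$; it is integral if $I\subseteq B$. $\mathrm{Inv}(B)$ is the group of invertible fractional ideals of $B$, $\mathrm{Princ}(B)$ the subgroup of nonzero principal fractional ideals, $\mathrm{Pic}(B)=\mathrm{Inv}(B)/\mathrm{Princ}(B)$. A retract $D$-algebra is a $D$-algebra $R$ that is an integral domain and admits a $D$-algebra homomorphism $\epsilon:R\to D$ (then $D\subseteq R$). For an extension $A\subseteq B$ of integral domains, with $F$ the quotient field of $A$: a fractional ideal $I$ of $B$ is unitary with respect to $A$ if $I\cap F\neq(0)$. $\mathrm{Inv}_u(B,A)$ is the subgroup of $\mathrm{Inv}(B)$ generated by the invertible ideals that are both integral and unitary with respect to $A$; $\mathrm{Pic}_u(B,A):=\mathrm{Inv}_u(B,A)/(\mathrm{Inv}_u(B,A)\cap\mathrm{Princ}(B))$, a subgroup of $\mathrm{Pic}(B)$. The canonical map $\iota:\mathrm{Pic}(A)\to\mathrm{Pic}(B)$,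 $[I]\mapsto[IB]$, has image in $\mathrm{Pic}_u(B,A)$, and $\mathrm{LPic}_u(B,A):=\mathrm{Pic}_u(B,A)/\iota(\mathrm{Pic}(A))$. $B$ is pseudo-polynomial over $A$ (a pseudo-polynomial $A$-algebra) if every principal integral ideal of $B$ that is unitary with respect to $A$ is generated by an element of $A$. An overring of $D$ is a ring between $D$ and $K$; it is flat if it is flat as a $D$-module. $RT$ is the subring of the quotient field of $R$ consisting of finite sums $\sum r_it_i$ with $r_i\in R$, $t_i\in T$. A family $\Theta$ of flat overrings of $D$ is complete if $I=\bigcap_{T\in\Theta}IT$ for every ideal $I$ of $D$; independent if $TT'=K$ for all $T\neq T'$ in $\Theta$; locally finite if every nonzero $x\in D$ is a non-unit in only finitely many $T\in\Theta$. A Jaffard family of $D$ is a complete, independent, locally finite family of flat overrings with $K\notin\Theta$; a Jaffard overring of $D$ is a member of some Jaffard family of $D$. The Zariski topology on the set of overrings of $D$ is generated by the sets of all overrings containing $x$, for $x\in K$. A pre-Jaffard family of $D$ is a complete, independent family $\Theta$ of flat overrings of $D$, compact in the Zariski topology, with $K\notin\Theta$. For a pre-Jaffard family $\Theta$ of $D$ define by transfinite recursion: $\mathcal{N}^0(\Theta):=\Theta$, $T_0:=D$; if $\alpha=\gamma+1$, $\mathcal{N}^\alpha(\Theta)$ is the set of members of $\mathcal{N}^\gamma(\Theta)$ that are not Jaffard overrings of $T_\gamma$; if $\alpha$ is a limit ordinal, $\mathcal{N}^\alpha(\Theta):=\bigcap_{\gamma<\alpha}\mathcal{N}^\gamma(\Theta)$;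 and $T_\alpha:=\bigcap\{T\mid T\in\mathcal{N}^\alpha(\Theta)\}$, the empty intersection being $K$. $\Theta$ is sharp if $T_\alpha=K$ for some ordinal $\alpha$. *)

(* Defs.v *)
From HB Require Import structures.
From mathcomp Require Import all_boot all_order all_algebra.
From mathcomp Require Import generic_quotient ring_quotient fraction.
From mathcomp Require Import all_classical.
From mathcomp Require Import topology.
From mathcomp.multinomials Require Import freeg.

Set Implicit Arguments.
Unset Strict Implicit.
Unset Printing Implicit Defensive.

Import GRing.Theory.
Local Open Scope classical_set_scope.
Local Open Scope ring_scope.
Local Open Scope quotient_scope.

Definition zmod_iso (V W : zmodType) : Prop :=
  exists f : {additive V -> W}, bijective f.

Definition free_abelian (V : zmodType) : Prop :=
  exists X : choiceType, zmod_iso {freeg X / int} V.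

Section GeneratedSubgroup.
Variables (V : zmodType) (P : set V).

Definition gensub : {pred V} :=
  [pred x | `[< forall S : {pred V},
                  zmod_closed S -> (forall y, P y -> y \in S) -> x \in S >]].

Lemma gensub_closed : zmod_closed gensub.
Proof.
split=> [|x y /asboolP xP /asboolP yP]; apply/asboolP => S Scl PS.
  by case: Scl.
by case: (Scl) => _; apply; [exact: xP|exact: yP].
Qed.

HB.instance Definition _ := GRing.isZmodClosed.Build V gensub gensub_closed.
End GeneratedSubgroup.

Lemma gensub_additive (V W : zmodType) (P : set V) (S : zmodClosed W)
    (f : {additive V -> W}) :
  (forall y, P y -> f y \in S) -> forall x, x \in gensub P -> f x \in S.
Proof.
move=> PS x /asboolP/(_ [pred u | f u \in S]); apply=> // {x}.
split=> [|x y xS yS]; rewrite inE ?raddf0 ?rpred0 // raddfB.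
exact: rpredB.
Qed.

(* [quot_map] does not depend on the representatives when f(I) is contained   *)
(* in J; this is not required by the definition.                              *)
Section QuotientMap.
Variables (V W : zmodType) (I : zmodClosed V) (J : zmodClosed W).
Variable f : {additive V -> W}.

Definition quot_map (x : Quotient.quot I) : Quotient.quot J :=
  \pi_(Quotient.quot J) (f (repr x)).

Hypothesis fIJ : forall x, x \in I -> f x \in J.

Lemma quot_mapE x :
  quot_map (\pi_(Quotient.quot I) x) = \pi_(Quotient.quot J) (f x).
Proof.
apply/eqP; rewrite /quot_map -Quotient.idealrBE -raddfB; apply: fIJ.
by rewrite Quotient.idealrBE reprK.
Qed.

Lemma quot_map_is_zmod_morphism : zmod_morphism quot_map.
Proof.
by move=> x y; rewrite -[x]reprK -[y]reprK -raddfB !quot_mapE !raddfB.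
Qed.
End QuotientMap.

Section DirectSum.
Variables (I : Type) (M : I -> zmodType).

Definition finsupp (f : forall i, M i) : bool :=
  `[< finite_set [set i | f i != 0] >].

Record dsum := Dsum { dsum_val : forall i, M i; _ : finsupp dsum_val }.

HB.instance Definition _ := [isSub for dsum_val].
HB.instance Definition _ := [Choice of dsum by <:].

Lemma finsupp0 : finsupp (fun=> 0).
Proof.
apply/asboolP; rewrite (_ : [set _ | _] = set0) //.
by rewrite predeqE => i /=; rewrite eqxx.
Qed.

Lemma finsuppN (f : dsum) : finsupp (fun i => - dsum_val f i).
Proof.
apply/asboolP; case: f => f /= /asboolP; apply: sub_finite_set => i /=.
by rewrite oppr_eq0.
Qed.

Lemma finsuppD (f g : dsum) : finsupp (fun i => dsum_val f i + dsum_val g i).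
Proof.
apply/asboolP; case: f g => f /= /asboolP fP [g /= /asboolP gP].
apply: (@sub_finite_set _ _ ([set i | f i != 0] `|` [set i | g i != 0])).
  move=> i /=; have [->|_ _] := eqVneq (f i) 0; last by left.
  by rewrite add0r; right.
by rewrite finite_setU.
Qed.

Definition dsum0 := Dsum finsupp0.
Definition dsumN f := Dsum (finsuppN f).
Definition dsumD f g := Dsum (finsuppD f g).

Lemma dsum_addA : associative dsumD.
Proof.
by move=> f g h; apply/val_inj/functional_extensionality_dep => i /=; rewrite addrA.
Qed.
Lemma dsum_addC : commutative dsumD.
Proof.
by move=> f g; apply/val_inj/functional_extensionality_dep => i /=; rewrite addrC.
Qed.
Lemma dsum_add0 : left_id dsum0 dsumD.
Proof.
by move=> f; apply/val_inj/functional_extensionality_dep => i /=; rewrite add0r.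
Qed.
Lemma dsum_addN : left_inverse dsum0 dsumN dsumD.
Proof.
by move=> f; apply/val_inj/functional_extensionality_dep => i /=; rewrite addNr.
Qed.

HB.instance Definition _ :=
  GRing.isZmodule.Build dsum dsum_addA dsum_addC dsum_add0 dsum_addN.
End DirectSum.

Section Tensor.
Variables (A : comNzRingType) (M N : lmodType A).

Local Notation FMN := {freeg (M * N)%type / int}.
Local Notation gen m n := (<< (m, n) >> : FMN).

Definition tensor_relations : set FMN :=
  [set z | [\/ exists m m' n, z = gen (m + m') n - gen m n - gen m' n,
               exists m n n', z = gen m (n + n') - gen m n - gen m n' |
               exists (a : A) m n, z = gen (a *: m) n - gen m (a *: n)]].

Definition tensor : zmodType := Quotient.quot (gensub tensor_relations).
End Tensor.

Section TensorMap.
Variables (A : comNzRingType) (M N P : lmodType A) (f : {linear N -> P}).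

Definition freeg_tensor_map (z : {freeg (M * N)%type / int}) :
    {freeg (M * P)%type / int} :=
  fglift (fun mn => << (mn.1, f mn.2) >> : {freeg (M * P)%type / int}) z.

Lemma freeg_tensor_map_is_zmod_morphism : zmod_morphism freeg_tensor_map.
Proof. exact: lift_is_additive. Qed.
HB.instance Definition _ := GRing.isZmodMorphism.Build _ _ freeg_tensor_map
  freeg_tensor_map_is_zmod_morphism.

Lemma freeg_tensor_mapU (m : M) (n : N) :
  freeg_tensor_map << (m, n) >> = << (m, f n) >>.
Proof. by rewrite /freeg_tensor_map liftU scale1r. Qed.

Lemma freeg_tensor_map_relations z :
  tensor_relations z -> freeg_tensor_map z \in gensub (@tensor_relations A M P).
Proof.
move=> Rz; apply/asboolP => S _; apply.
case: Rz => [[m [m' [n ->]]]|[m [n [n' ->]]]|[a [m [n ->]]]];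
  rewrite ?raddfB /= !freeg_tensor_mapU ?linearD ?linearZ /=.
- by constructor 1; exists m, m', (f n).
- by constructor 2; exists m, (f n), (f n').
- by constructor 3; exists a, m, (f n).
Qed.

Definition tensor_map : tensor M N -> tensor M P :=
  quot_map (I := gensub (@tensor_relations A M N))
    (gensub (@tensor_relations A M P)) freeg_tensor_map.

Lemma tensor_mapE z :
  tensor_map (\pi_(tensor M N) z) = \pi_(tensor M P) (freeg_tensor_map z).
Proof.
apply: quot_mapE; apply: gensub_additive; exact: freeg_tensor_map_relations.
Qed.
End TensorMap.

Definition flat_module (A : comNzRingType) (M : lmodType A) : Prop :=
  forall (N P : lmodType A) (f : {linear N -> P}),
    injective f -> injective (tensor_map (M := M) f).

Definition restrict_scalars (A B : comNzRingType) (phi : {rmorphism A -> B})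
  : Type := B.

Section RestrictScalars.
Variables (A B : comNzRingType) (phi : {rmorphism A -> B}).
HB.instance Definition _ := GRing.Zmodule.on (restrict_scalars phi).

Definition rs_scale (a : A) (b : restrict_scalars phi) : restrict_scalars phi :=
  phi a * (b : B).

Lemma rs_scaleA a b v : rs_scale a (rs_scale b v) = rs_scale (a * b) v.
Proof. by rewrite /rs_scale rmorphM mulrA. Qed.
Lemma rs_scale1 : left_id 1 rs_scale.
Proof. by move=> v; rewrite /rs_scale rmorph1 mul1r. Qed.
Lemma rs_scaleDr : right_distributive rs_scale +%R.
Proof. by move=> a u v; rewrite /rs_scale mulrDr. Qed.
Lemma rs_scaleDl v : {morph rs_scale^~ v : a b / a + b}.
Proof. by move=> a b; rewrite /rs_scale rmorphD mulrDl. Qed.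

HB.instance Definition _ := GRing.Zmodule_isLmodule.Build A
  (restrict_scalars phi) rs_scaleA rs_scale1 rs_scaleDr rs_scaleDl.
End RestrictScalars.

(* All domains live in a fixed ambient field [L]. *)
Record subring (L : fieldType) := Subring {
  subring_pred :> {pred L};
  subring_closedP : subring_closed subring_pred }.

Section Subring.
Variable L : fieldType.
Implicit Types A B T : subring L.

HB.instance Definition _ A :=
  GRing.isSubringClosed.Build L (subring_pred A) (subring_closedP A).

HB.instance Definition _ := gen_eqMixin (subring L).
HB.instance Definition _ := gen_choiceMixin (subring L).

Lemma subring_eq A B : A =i B -> A = B.
Proof.
case: A B => A Ac [B Bc] /= AB.
have {}AB : A = B by apply/funext => x; exact: AB.
by rewrite AB in Ac *; congr Subring; exact: Prop_irrelevance.
Qed.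

Definition subring_sort A : Type := {x : L | x \in subring_pred A}.
HB.instance Definition _ A := SubChoice.on (subring_sort A).
HB.instance Definition _ A :=
  [SubChoice_isSubComNzRing of subring_sort A by <:].

Section Incl.
Variables (A B : subring L) (AB : {subset A <= B}).
Definition subring_incl (x : subring_sort A) : subring_sort B :=
  Sub (val x) (AB (valP x)).
Lemma subring_incl_zmod : zmod_morphism subring_incl.
Proof. by move=> x y; apply: val_inj. Qed.
Lemma subring_incl_monoid : monoid_morphism subring_incl.
Proof. by split=> [|x y]; apply: val_inj. Qed.
HB.instance Definition _ := GRing.isZmodMorphism.Build _ _ subring_incl
  subring_incl_zmod.
HB.instance Definition _ := GRing.isMonoidMorphism.Build _ _ subring_incl
  subring_incl_monoid.
End Incl.

Definition flat_over A T : Prop :=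
  exists AT : {subset A <= T}, flat_module (restrict_scalars (subring_incl AT)).

Definition frac_pred A : {pred L} :=
  [pred x | `[< exists a b, [/\ a \in A, b \in A, b != 0 & x = a / b] >]].

Lemma frac_closed A : subring_closed (frac_pred A).
Proof.
split=> [|x y|x y].
- by apply/asboolP; exists 1, 1; rewrite rpred1 oner_eq0 divr1.
- move=> /asboolP[a [b [aA bA b0 ->]]] /asboolP[c [d [cA dA d0 ->]]].
  apply/asboolP; exists (a * d - c * b), (b * d).
  by rewrite rpredB ?rpredM ?mulf_neq0 // -mulNr addf_div // mulNr.
- move=> /asboolP[a [b [aA bA b0 ->]]] /asboolP[c [d [cA dA d0 ->]]].
  apply/asboolP; exists (a * c), (b * d).
  by rewrite !rpredM ?mulf_neq0 // mulf_div.
Qed.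

HB.instance Definition _ A :=
  GRing.isSubringClosed.Build L (frac_pred A) (frac_closed A).
Definition frac A : subring L := Subring (frac_closed A).

Lemma sub_frac A : {subset A <= frac A}.
Proof.
by move=> x xA; apply/asboolP; exists x, 1; rewrite rpred1 oner_eq0 divr1.
Qed.

Lemma fracS A B : {subset A <= B} -> {subset frac A <= frac B}.
Proof.
move=> AB x /asboolP[a [b [aA bA b0 ->]]]; apply/asboolP.
by exists a, b; split=> //; apply: AB.
Qed.

(* Finite sums of products: this gives the product [IJ] of ideals, the        *)
(* extension [IT] of an ideal and the compositum [RT] of two subrings.        *)
Definition setprod (S T : set L) : set L :=
  [set x | exists2 r : seq (L * L),
     forall p, p \in r -> S p.1 /\ T p.2 & x = \sum_(p <- r) p.1 * p.2].

Lemma setprod0 (S T : set L) : setprod S T 0.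
Proof. by exists [::]; rewrite ?big_nil. Qed.

Lemma setprodD (S T : set L) x y :
  setprod S T x -> setprod S T y -> setprod S T (x + y).
Proof.
move=> [r rP ->] [s sP ->]; exists (r ++ s); last by rewrite big_cat.
by move=> p; rewrite mem_cat => /orP[/rP|/sP].
Qed.

Lemma mem_setprod (S T : set L) x y : S x -> T y -> setprod S T (x * y).
Proof.
move=> Sx Ty; exists [:: (x, y)]; last by rewrite big_seq1.
by move=> p; rewrite inE => /eqP->.
Qed.

Lemma setprod_ind (S T U : set L) :
  U 0 -> (forall x y, U x -> U y -> U (x + y)) ->
  (forall x y, S x -> T y -> U (x * y)) -> setprod S T `<=` U.
Proof.
move=> U0 UD UM x [r + ->]; elim: r => [|p r IH] rP; first by rewrite big_nil.
have [Sp Tp] := rP p (mem_head _ _).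
rewrite big_cons; apply: UD; first exact: UM.
by apply: IH => q qr; apply: rP; rewrite inE qr orbT.
Qed.

Lemma setprodS (S S' T T' : set L) :
  S `<=` S' -> T `<=` T' -> setprod S T `<=` setprod S' T'.
Proof.
move=> SS TT x [r rP ->]; exists r => // p /rP[Sp Tp].
by split; [apply: SS|apply: TT].
Qed.

Lemma setprodC (S T : set L) : setprod S T = setprod T S.
Proof.
suff sub (S' T' : set L) : setprod S' T' `<=` setprod T' S' by apply/seteqP; split.
apply: setprod_ind => [|x y|x y Sx Ty]; first exact: setprod0.
  exact: setprodD.
by rewrite mulrC; exact: mem_setprod.
Qed.

Lemma setprodA (S T U : set L) :
  setprod S (setprod T U) = setprod (setprod S T) U.
Proof.
have sub (S' T' U' : set L) :
    setprod S' (setprod T' U') `<=` setprod (setprod S' T') U'.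
  apply: setprod_ind => [|x y|x y Sx]; first exact: setprod0.
    exact: setprodD.
  apply: (@setprod_ind _ _ [set y | setprod (setprod S' T') U' (x * y)]) => /=.
  - by rewrite mulr0; exact: setprod0.
  - by move=> u v xu xv; rewrite mulrDr; exact: setprodD.
  - by move=> t u Tt Uu; rewrite mulrA; do 2!apply: mem_setprod => //.
apply/seteqP; split; first exact: sub.
rewrite (setprodC S (setprod T U)) (setprodC T U) (setprodC (setprod S T) U).
by rewrite (setprodC S T); exact: sub.
Qed.

Definition compositum_pred A B : {pred L} :=
  [pred x | `[< setprod [set` A] [set` B] x >]].

Lemma compositum_closed A B : subring_closed (compositum_pred A B).
Proof.
split=> [|x y|x y].
- by apply/asboolP; rewrite -[1]mulr1; apply: mem_setprod; exact: rpred1.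
- move=> /asboolP xP /asboolP yP; apply/asboolP/setprodD => //.
  apply: (@setprod_ind [set` A] [set` B]
            [set z | setprod [set` A] [set` B] (- z)]) yP => /=.
  + by rewrite oppr0; exact: setprod0.
  + by move=> u v u' v'; rewrite opprD; exact: setprodD.
  + by move=> u v u' v'; rewrite -mulNr; apply: mem_setprod; rewrite //= rpredN.
- move=> /asboolP xP /asboolP yP; apply/asboolP.
  have := mem_setprod xP yP.
  rewrite -setprodA (setprodC [set` B]) -setprodA setprodA.
  have sub (C : subring L) : setprod [set` C] [set` C] `<=` [set` C].
    by apply: setprod_ind => [|u v|u v] /=;
      [exact: rpred0|exact: rpredD|exact: rpredM].
  exact: setprodS (sub A) (sub B) _.
Qed.

HB.instance Definition _ A B :=
  GRing.isSubringClosed.Build L (compositum_pred A B) (compositum_closed A B).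
Definition compositum A B : subring L := Subring (compositum_closed A B).

Lemma sub_compositumr A B : {subset B <= compositum A B}.
Proof.
move=> x xB; apply/asboolP; rewrite -[x]mul1r.
by apply: mem_setprod; rewrite //= rpred1.
Qed.

Definition submodule A (I : set L) : Prop :=
  [/\ I 0, forall x y, I x -> I y -> I (x + y) &
      forall a x, a \in A -> I x -> I (a * x)].

Definition integral_ideal A (I : set L) : Prop :=
  submodule A I /\ I `<=` [set` A].

Definition fractional A (I : set L) : Prop :=
  [/\ submodule A I, I `<=` [set` frac A] &
      exists2 b, b \in A /\ b != 0 & forall x, I x -> b * x \in A].

Definition invertible A (I : set L) : Prop :=
  fractional A I /\
  exists2 J, fractional A J & setprod I J = [set` A].

Lemma setprod1 A I : submodule A I -> setprod [set` A] I = I.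
Proof.
case=> I0 ID IM; apply/seteqP; split; first exact: setprod_ind.
by move=> x Ix; rewrite -[x]mul1r; apply: mem_setprod => //=; exact: rpred1.
Qed.

Lemma submodule1 A : submodule A [set` A].
Proof. by split=> [|x y|x y] /=; [exact: rpred0|exact: rpredD|exact: rpredM]. Qed.

Lemma fractional1 A : fractional A [set` A].
Proof.
split; first exact: submodule1.
  by move=> x; exact: sub_frac.
by exists 1; rewrite ?rpred1 ?oner_eq0 // => x; rewrite mul1r.
Qed.

Lemma fractionalM A I J :
  fractional A I -> fractional A J -> fractional A (setprod I J).
Proof.
move=> [[I0 ID IM] IF [b [bA b0] bI]] [[J0 JD JM] JF [c [cA c0] cJ]]; split.
- split; [exact: setprod0|by move=> x y; exact: setprodD|].
  move=> a x aA; apply: (@setprod_ind _ _ [set x | setprod I J (a * x)]) => /=.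
  + by rewrite mulr0; exact: setprod0.
  + by move=> u v uP vP; rewrite mulrDr; exact: setprodD.
  + by move=> u v Iu Jv; rewrite mulrA; apply: mem_setprod => //; exact: IM.
- apply: setprod_ind => [|x y|x y Ix Jy] /=; first exact: rpred0.
    exact: rpredD.
  by apply: rpredM; [exact: IF|exact: JF].
exists (b * c); first by rewrite rpredM ?mulf_neq0.
apply: (@setprod_ind _ _ [set x | b * c * x \in A]) => [|x y|x y Ix Jy] /=.
- by rewrite mulr0 rpred0.
- by move=> xA yA; rewrite mulrDr rpredD.
- by rewrite mulrACA rpredM ?bI ?cJ.
Qed.

Lemma invertible1 A : invertible A [set` A].
Proof.
split; first exact: fractional1.
exists [set` A]; first exact: fractional1.
by rewrite setprod1 //; exact: submodule1.
Qed.

Lemma invertibleM A I J :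
  invertible A I -> invertible A J -> invertible A (setprod I J).
Proof.
move=> [If [I' I'f II']] [Jf [J' J'f JJ']]; split; first exact: fractionalM.
exists (setprod J' I'); first exact: fractionalM.
rewrite -setprodA (setprodA J) JJ' setprod1 //; by case: I'f.
Qed.

(* Inv(A), with the product of ideals written additively. *)
Record inv_ideal A := InvIdeal {
  inv_val : set L;
  _ : `[< invertible A inv_val >] }.

HB.instance Definition _ A := [isSub for @inv_val A].
HB.instance Definition _ A := [Choice of inv_ideal A by <:].

Lemma inv_idealP A (I : inv_ideal A) : invertible A (inv_val I).
Proof. exact/asboolP/(valP I). Qed.

Definition inv_one A : inv_ideal A := InvIdeal (asboolT (invertible1 A)).
Definition inv_mul A (I J : inv_ideal A) : inv_ideal A :=
  InvIdeal (asboolT (invertibleM (inv_idealP I) (inv_idealP J))).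

Lemma inv_inv_subproof A (I : inv_ideal A) :
  exists J, `[< invertible A J >] /\ setprod J (inv_val I) = [set` A].
Proof.
have [If [J Jf IJ]] := inv_idealP I.
exists J; rewrite setprodC; split=> //; apply/asboolP; split=> //.
by exists (inv_val I); rewrite // setprodC.
Qed.

Definition inv_inv A (I : inv_ideal A) : inv_ideal A :=
  InvIdeal (projT2 (cid (inv_inv_subproof I))).1.

Lemma inv_mulA A : associative (@inv_mul A).
Proof. by move=> I J K; apply: val_inj; rewrite /= setprodA. Qed.
Lemma inv_mulC A : commutative (@inv_mul A).
Proof. by move=> I J; apply: val_inj; rewrite /= setprodC. Qed.
Lemma inv_mul1 A : left_id (@inv_one A) (@inv_mul A).
Proof.
by move=> I; apply: val_inj; rewrite /= setprod1 //; case: (inv_idealP I) => -[].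
Qed.
Lemma inv_mulV A : left_inverse (@inv_one A) (@inv_inv A) (@inv_mul A).
Proof.
by move=> I; apply: val_inj => /=; case: (projT2 (cid (inv_inv_subproof I))).
Qed.

HB.instance Definition _ A := GRing.isZmodule.Build (inv_ideal A)
  (@inv_mulA A) (@inv_mulC A) (@inv_mul1 A) (@inv_mulV A).

Lemma inv_val0 A : inv_val (0 : inv_ideal A) = [set` A]. Proof. by []. Qed.
Lemma inv_valD A (I J : inv_ideal A) :
  inv_val (I + J) = setprod (inv_val I) (inv_val J).
Proof. by []. Qed.

Definition principal A (x : L) : set L := [set x * a | a in [set` A]].

Definition princ_pred A : {pred inv_ideal A} :=
  [pred I | `[< exists x,
     [/\ x \in frac A, x != 0 & inv_val I = principal A x] >]].

Lemma principalM A x y :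
  setprod (principal A x) (principal A y) = principal A (x * y).
Proof.
apply/seteqP; split.
  apply: setprod_ind.
  - by exists 0; rewrite /= ?rpred0 ?mulr0.
  - move=> _ _ [a aA <-] [b bA <-]; exists (a + b); rewrite ?mulrDr //=.
    by rewrite rpredD.
  - move=> _ _ [a aA <-] [b bA <-]; exists (a * b); rewrite /= ?rpredM //.
    by rewrite mulrACA.
move=> _ [a aA <-]; rewrite mulrAC -[X in _ * X]mulr1.
by apply: mem_setprod; [exists a|exists 1 => //=; exact: rpred1].
Qed.

Lemma principal1 A : principal A 1 = [set` A].
Proof.
apply/seteqP; split=> [_ [a aA <-]|a aA]; first by rewrite mul1r.
by exists a; rewrite ?mul1r.
Qed.

Lemma frac_inv A x : x \in frac A -> x^-1 \in frac A.
Proof.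
move=> /asboolP[a [b [aA bA b0 ->]]]; rewrite invf_div.
have [->|a0] := eqVneq a 0; first by rewrite invr0 mulr0 rpred0.
by apply/asboolP; exists b, a.
Qed.

Lemma princ_closed A : zmod_closed (@princ_pred A).
Proof.
split=> [|I J].
  apply/asboolP; exists 1; rewrite rpred1 oner_eq0 principal1; split=> //.
move=> /asboolP[x [xF x0 xI]] /asboolP[y [yF y0 yJ]]; apply/asboolP.
exists (x / y); split; [by rewrite rpredM ?frac_inv|by rewrite mulf_neq0 ?invr_eq0|].
have NJ : inv_val (- J) = principal A y^-1.
  have J'1 : setprod (principal A y^-1) (inv_val J) = [set` A].
    by rewrite yJ principalM mulVf // principal1.
  have sub : submodule A (principal A y^-1).
    split=> [|_ _ [a aA <-] [b bA <-]|c _ cA [a aA <-]].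
    - by exists 0; rewrite /= ?rpred0 ?mulr0.
    - by exists (a + b); rewrite ?mulrDr //= rpredD.
    - by exists (c * a); rewrite 1?mulrCA //= rpredM.
  rewrite -(setprod1 sub) setprodC -(inv_val0 A) -(addrN J) inv_valD setprodA J'1.
  by rewrite setprod1 //; case: (inv_idealP (- J)) => -[].
by rewrite inv_valD NJ xI principalM.
Qed.

HB.instance Definition _ A :=
  GRing.isZmodClosed.Build (inv_ideal A) (@princ_pred A) (@princ_closed A).

Definition pic A : zmodType := Quotient.quot (@princ_pred A).

Definition unitary A (I : set L) : Prop := I `&` [set` frac A] <> [set 0].

Definition invu_pred B A : {pred inv_ideal B} :=
  gensub [set I : inv_ideal B |
    integral_ideal B (inv_val I) /\ unitary A (inv_val I)].

HB.instance Definition _ B A := GRing.ZmodClosed.on (@invu_pred B A).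

Definition invu B A : Type := {I : inv_ideal B | I \in @invu_pred B A}.
HB.instance Definition _ B A := SubChoice.on (invu B A).
HB.instance Definition _ B A := [SubChoice_isSubZmodule of invu B A by <:].

Definition princu_pred B A : {pred invu B A} :=
  [pred I | val I \in @princ_pred B].

Lemma princu_closed B A : zmod_closed (@princu_pred B A).
Proof.
split=> [|I J]; first exact: (rpred0 (@princ_pred B)).
exact: (@rpredB _ (@princ_pred B)).
Qed.

HB.instance Definition _ B A :=
  GRing.isZmodClosed.Build (invu B A) (@princu_pred B A) (@princu_closed B A).

Definition picu B A : zmodType := Quotient.quot (@princu_pred B A).

Lemma princu_val B A (I : invu B A) :
  I \in @princu_pred B A -> val I \in @princ_pred B.
Proof. by []. Qed.

Definition picu_incl B A : picu B A -> pic B :=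
  quot_map (I := @princu_pred B A) (@princ_pred B)
    (val : invu B A -> inv_ideal B).

Lemma picu_inclE B A (I : invu B A) :
  picu_incl (\pi_(picu B A) I) = \pi_(pic B) (val I).
Proof. exact/quot_mapE/princu_val. Qed.

HB.instance Definition _ B A := GRing.isZmodMorphism.Build (picu B A) (pic B)
  (@picu_incl B A) (quot_map_is_zmod_morphism (@princu_val B A)).

Section Extension.
Variables (A B : subring L) (AB : {subset A <= B}).

Lemma setprod_sub : setprod [set` A] [set` B] = [set` B].
Proof.
apply/seteqP; split=> [|x Bx].
  apply: setprod_ind => [|x y|x y Ax By] /=; [exact: rpred0|exact: rpredD|].
  by rewrite rpredM // AB.
by rewrite -[x]mul1r; apply: mem_setprod; rewrite //= rpred1.
Qed.

Lemma setprod_ext I J :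
  setprod (setprod I [set` B]) (setprod J [set` B]) =
  setprod (setprod I J) [set` B].
Proof.
rewrite (setprodC J) setprodA -(setprodA I) (setprod1 (submodule1 B)).
by rewrite -!setprodA (setprodC J).
Qed.

Lemma fractional_ext I : fractional A I -> fractional B (setprod I [set` B]).
Proof.
move=> [_ IF [b [bA b0] bI]]; split.
- split; [exact: setprod0|by move=> x y; exact: setprodD|].
  move=> a x aB.
  apply: (@setprod_ind _ _ [set x | setprod I [set` B] (a * x)]) => /=.
  + by rewrite mulr0; exact: setprod0.
  + by move=> u v uP vP; rewrite mulrDr; exact: setprodD.
  + by move=> u v Iu Bv; rewrite mulrCA; apply: mem_setprod; rewrite //= rpredM.
- apply: setprod_ind => [|x y|x y Ix By] /=; [exact: rpred0|exact: rpredD|].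
  by apply: rpredM; [exact/(fracS AB)/IF|exact: sub_frac].
exists b; first by split=> //; exact: AB.
apply: (@setprod_ind _ _ [set x | b * x \in B]) => [|x y|x y Ix By] /=.
- by rewrite mulr0 rpred0.
- by move=> xB yB; rewrite mulrDr rpredD.
- by rewrite mulrA rpredM // AB // bI.
Qed.

Lemma invertible_ext I : invertible A I -> invertible B (setprod I [set` B]).
Proof.
move=> [If [J Jf IJ]]; split; first exact: fractional_ext.
exists (setprod J [set` B]); first exact: fractional_ext.
by rewrite setprod_ext IJ setprod_sub.
Qed.

Definition inv_ext (I : inv_ideal A) : inv_ideal B :=
  InvIdeal (asboolT (invertible_ext (inv_idealP I))).

Lemma inv_ext_is_nmod_morphism : {morph inv_ext : I J / I + J}.
Proof.
by move=> I J; apply: val_inj; rewrite /= setprod_ext.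
Qed.

Lemma inv_ext_is_zmod_morphism : zmod_morphism inv_ext.
Proof.
move=> I J; apply/eqP; rewrite eq_sym subr_eq -inv_ext_is_nmod_morphism.
by rewrite subrK.
Qed.
HB.instance Definition _ := GRing.isZmodMorphism.Build (inv_ideal A)
  (inv_ideal B) inv_ext inv_ext_is_zmod_morphism.

Lemma inv_ext_princ I : I \in @princ_pred A -> inv_ext I \in @princ_pred B.
Proof.
move=> /asboolP[x [xF x0 xI]]; apply/asboolP; exists x.
split=> //; first exact: (fracS AB).
rewrite /= xI; apply/seteqP; split.
  apply: setprod_ind => [|_ _ [a aB <-] [b bB <-]|_ b [a aA <-] bB].
  - by exists 0; rewrite /= ?rpred0 ?mulr0.
  - by exists (a + b); rewrite ?mulrDr //= rpredD.
  - by exists (a * b); rewrite ?mulrA //= rpredM // AB.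
move=> _ [b bB <-]; apply: mem_setprod => //.
by exists 1; rewrite ?mulr1 //= rpred1.
Qed.

(* The canonical map iota : Pic(A) -> Pic(B), [I] |-> [IB]. *)
Definition pic_ext : pic A -> pic B :=
  quot_map (I := @princ_pred A) (@princ_pred B) inv_ext.

Lemma pic_extE I : pic_ext (\pi_(pic A) I) = \pi_(pic B) (inv_ext I).
Proof. exact/quot_mapE/inv_ext_princ. Qed.

HB.instance Definition _ := GRing.isZmodMorphism.Build (pic A) (pic B)
  pic_ext (quot_map_is_zmod_morphism inv_ext_princ).

Definition iota_pred : {pred picu B A} :=
  [pred x | `[< exists c : pic A, picu_incl x = pic_ext c >]].

Lemma iota_closed : zmod_closed iota_pred.
Proof.
split=> [|x y /asboolP[c xc] /asboolP[d yd]]; apply/asboolP.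
  by exists 0; rewrite !raddf0.
by exists (c - d); rewrite !raddfB /= xc yd.
Qed.
HB.instance Definition _ :=
  GRing.isZmodClosed.Build (picu B A) iota_pred iota_closed.

Definition lpicu : zmodType := Quotient.quot iota_pred.
End Extension.

Definition pseudo_polynomial A B : Prop :=
  forall b, b \in B -> unitary A (principal B b) ->
    exists2 a, a \in A & principal B b = principal B a.

Definition overring A T : Prop :=
  {subset A <= T} /\ {subset T <= frac A}.

(* Intersecting with [frac A] makes the empty intersection equal to it. *)
Definition complete_family A (Th : set (subring L)) : Prop :=
  forall I, integral_ideal A I ->
    I = [set` frac A] `&` \bigcap_(T in Th) setprod I [set` T].

Definition independent_family A (Th : set (subring L)) : Prop :=
  forall T T', Th T -> Th T' -> T <> T' -> compositum T T' = frac A.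

Definition locally_finite_family A (Th : set (subring L)) : Prop :=
  forall x, x \in A -> x != 0 ->
    finite_set [set T | Th T /\ ~ exists2 y, y \in T & x * y = 1].

Definition flat_overrings A (Th : set (subring L)) : Prop :=
  forall T, Th T -> overring A T /\ flat_over A T.

Definition jaffard_family A (Th : set (subring L)) : Prop :=
  [/\ flat_overrings A Th, complete_family A Th, independent_family A Th,
      locally_finite_family A Th & ~ Th (frac A)].

Definition jaffard_overring A T : Prop :=
  exists2 Th, jaffard_family A Th & Th T.

Definition overrings A : Type := {T : subring L | `[< overring A T >]}.
HB.instance Definition _ A := Choice.on (overrings A).
HB.instance Definition _ A := isSubBaseTopological.Build (overrings A)
  [set U : set (overrings A) |
     exists2 x, x \in frac A & U = [set T : overrings A | x \in sval T]] id.

Definition pre_jaffard_family A (Th : set (subring L)) : Prop :=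
  [/\ flat_overrings A Th, complete_family A Th, independent_family A Th,
      compact [set T : overrings A | Th (sval T)] & ~ Th (frac A)].

(* The intersection is taken inside [frac A], so that the empty one is         *)
(* [frac A].                                                                  *)
Section FamilyMeet.
Variables (A : subring L) (Th : set (subring L)).

Definition family_meet_pred : {pred L} :=
  [pred x | `[< x \in frac A /\ forall T, Th T -> x \in T >]].

Lemma family_meet_closed : subring_closed family_meet_pred.
Proof.
split=> [|x y /asboolP[xF xT] /asboolP[yF yT]
         |x y /asboolP[xF xT] /asboolP[yF yT]]; apply/asboolP.
- by split=> [|T _]; exact: rpred1.
- split=> [|T TT]; first exact: rpredB.
  by apply: rpredB; [exact: xT|exact: yT].
- split=> [|T TT]; first exact: rpredM.
  by apply: rpredM; [exact: xT|exact: yT].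
Qed.

HB.instance Definition _ :=
  GRing.isSubringClosed.Build L family_meet_pred family_meet_closed.
Definition family_meet : subring L := Subring family_meet_closed.
End FamilyMeet.

(* Ordinals are represented by the elements of well-ordered types. *)
Section Ordinals.
Variables (W : Type) (le : rel W).
Definition ord_lt (c a : W) : Prop := ~~ le a c.
Definition ord_zero (a : W) : Prop := forall c, ~ ord_lt c a.
Definition ord_succ (c a : W) : Prop :=
  ord_lt c a /\ forall b, ~ (ord_lt c b /\ ord_lt b a).
Definition ord_limit (a : W) : Prop :=
  ~ ord_zero a /\ forall c, ~ ord_succ c a.
End Ordinals.

(* [N a] is N^a(Th) and [TT a] is T_a. *)
Definition derived_sequence A (Th : set (subring L)) (W : Type) (le : rel W)
    (N : W -> set (subring L)) (TT : W -> subring L) : Prop :=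
  forall a,
  [/\ ord_zero le a -> N a = Th /\ TT a = A,
      forall c, ord_succ le c a ->
        N a = [set T | N c T /\ ~ jaffard_overring (TT c) T],
      ord_limit le a -> N a = \bigcap_(c in [set c | ord_lt le c a]) N c &
      ~ ord_zero le a -> TT a = family_meet A (N a)].

(* The clauses of [derived_sequence] have a unique solution over every        *)
(* well-ordered type.                                                         *)
Section Recursion.
Variables (A : subring L) (Th : set (subring L)) (W : Type) (le : rel W).
Hypothesis le_wo : wochoice.well_order le.

Lemma wo_min (P : set W) : (exists x, P x) ->
  exists2 z, P z & forall x, P x -> le z x.
Proof.
move=> [x Px]; have [|z [[zP zmin] _]] := le_wo (A := [pred x | `[< P x >]]).
  by exists x; apply/asboolP.
by exists z; [exact/asboolP|move=> y Py; apply: zmin; exact/asboolP].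
Qed.

Lemma ord_lt_wf : well_founded (ord_lt le).
Proof.
move=> x; apply: contrapT => xN.
have [|z zN zmin] := wo_min (P := [set x | ~ Acc (ord_lt le) x]).
  by exists x.
by apply: zN; split=> y yz; apply: contrapT => /zmin zy; rewrite /ord_lt zy in yz.
Qed.

Lemma wo_total x y : le x y \/ le y x.
Proof.
have [|z [->|->] zmin] := wo_min (P := [set z | z = x \/ z = y]).
- by exists x; left.
- by left; apply: zmin; right.
- by right; apply: zmin; left.
Qed.

Lemma wo_anti x y : le x y -> le y x -> x = y.
Proof.
have rfl z : le z z by case: (wo_total z z).
move=> xy yx.
have [|z [_ zu]] := le_wo (A := [pred z | `[< z = x \/ z = y >]]).
  by exists x; apply/asboolP; left.
have mx : wochoice.minimum_of le [pred z | `[< z = x \/ z = y >]] x.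
  by split=> [|u /asboolP[->|->]] //; apply/asboolP; left.
have my : wochoice.minimum_of le [pred z | `[< z = x \/ z = y >]] y.
  by split=> [|u /asboolP[->|->]] //; apply/asboolP; right.
by rewrite -(zu x mx) -(zu y my).
Qed.

Lemma ord_succ_inj c c' a : ord_succ le c a -> ord_succ le c' a -> c = c'.
Proof.
move=> [ca cN] [c'a c'N]; apply: wo_anti; apply/negP => /negP lt.
  by apply: (c'N c).
by apply: (cN c').
Qed.

Let step a (rec : forall c, ord_lt le c a -> set (subring L) * subring L) :
    set (subring L) * subring L :=
  let g c := if pselect (ord_lt le c a) is left h then rec c h else (set0, A) in
  if `[< ord_zero le a >] then (Th, A) else
  let N := if `[< exists c, ord_succ le c a >]
    then [set T | exists c, [/\ ord_succ le c a, (g c).1 T &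
                                ~ jaffard_overring (g c).2 T]]
    else \bigcap_(c in [set c | ord_lt le c a]) (g c).1 in
  (N, family_meet A N).

Lemma derived_sequence_ex : exists N TT, derived_sequence A Th le N TT.
Proof.
pose F := Fix ord_lt_wf (fun=> (set (subring L) * subring L)%type) step.
have FE a : F a = step (a := a) (fun c _ => F c).
  rewrite /F Fix_eq // => x f g fg; congr step.
  by apply: functional_extensionality_dep => c;
     apply: functional_extensionality_dep => h.
exists (fun a => (F a).1), (fun a => (F a).2) => a; split.
- by move=> a0; rewrite FE /step asboolT.
- move=> c ca; have a0 : ~ ord_zero le a by move=> /(_ c); apply; case: ca.
  rewrite FE /step asboolF // asboolT; last by exists c.
  apply/seteqP; split=> T /=.
    move=> [c' [c'a]]; rewrite (ord_succ_inj c'a ca).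
    by case: pselect => // -[]; case: ca.
  by move=> [FT JT]; exists c; split=> //; case: pselect => // -[]; case: ca.
- move=> [a0 aS]; rewrite FE /step asboolF // asboolF; last by case=> c /aS.
  by apply: eq_bigcapr => c /= ca; case: pselect.
- by move=> a0; rewrite FE /step asboolF.
Qed.

Lemma derived_sequence_unique N TT N' TT' :
  derived_sequence A Th le N TT -> derived_sequence A Th le N' TT' ->
  N = N' /\ TT = TT'.
Proof.
move=> dN dN'; suff E a : N a = N' a /\ TT a = TT' a.
  by split; apply/funext => a; case: (E a).
elim/(well_founded_ind ord_lt_wf): a => a IH.
have [z s l t] := dN a; have [z' s' l' t'] := dN' a.
have [a0|a0] := pselect (ord_zero le a).
  by have [-> ->] := z a0; have [-> ->] := z' a0.
suff E : N a = N' a by rewrite t // t' // E.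
have [[c ca]|aS] := pselect (exists c, ord_succ le c a).
  by rewrite (s c) // (s' c) //; have [|-> ->] := IH c; first by case: ca.
have al : ord_limit le a by split=> // c ca; apply: aS; exists c.
by rewrite l // l' //; apply: eq_bigcapr => c /= /IH[].
Qed.
End Recursion.

Definition sharp A (Th : set (subring L)) : Prop :=
  exists (W : Type) (le : rel W) (N : W -> set (subring L))
    (TT : W -> subring L) (a : W),
  [/\ wochoice.well_order le, derived_sequence A Th le N TT & TT a = frac A].

End Subring.

(* A [D]-algebra is given by its structure morphism [j : D -> R]; a ring      *)
(* morphism R -> D is [D]-linear if and only if it is a left inverse of [j].  *)
Definition retract_algebra (D R : idomainType) (j : {rmorphism D -> R}) : Prop :=
  exists eps : {rmorphism R -> D}, forall d, eps (j d) = d.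

Section ImageSubring.
Variables (S : comNzRingType) (L : fieldType) (f : {rmorphism S -> L}).

Definition image_pred : {pred L} := [pred x | `[< exists s, x = f s >]].

Lemma image_closed : subring_closed image_pred.
Proof.
split=> [|x y /asboolP[s ->] /asboolP[t ->]|x y /asboolP[s ->] /asboolP[t ->]];
  apply/asboolP.
- by exists 1; rewrite rmorph1.
- by exists (s - t); rewrite rmorphB.
- by exists (s * t); rewrite rmorphM.
Qed.

HB.instance Definition _ :=
  GRing.isSubringClosed.Build L image_pred image_closed.
Definition image_subring : subring L := Subring image_closed.
End ImageSubring.

(* [R] and [D] inside the quotient field of [R]. *)
Section Ambient.
Variables (D R : idomainType) (j : {rmorphism D -> R}).

Definition ring_in_frac : subring {fraction R} :=
  image_subring (@tofrac R).

Definition base_in_frac : subring {fraction R} :=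
  image_subring (@tofrac R \o j).

Lemma base_sub_ring : {subset base_in_frac <= ring_in_frac}.
Proof. by move=> x /asboolP[d ->]; apply/asboolP; exists (j d). Qed.
End Ambient.

(* Main.v *)
From HB Require Import structures.
From mathcomp Require Import all_boot all_order all_algebra.
From mathcomp Require Import generic_quotient ring_quotient.
From mathcomp Require Import fraction all_classical.
From mathcomp Require Import topology.
From mathcomp.multinomials Require Import freeg.
Require Import Defs.

Set Implicit Arguments.
Unset Strict Implicit.
Unset Printing Implicit Defensive.

Import GRing.Theory.
Local Open Scope classical_set_scope.
Local Open Scope ring_scope.
Local Open Scope quotient_scope.

(** Write K for the quotient field of D, and BT for the compositum of an
    extension B of D with a member T of Theta.  An invertible ideal of BT
    belongs to Inv_u(BT, T) exactly when it lies between xBT and x^-1 BT for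
    some nonzero x in D ([invu_predP]); as R is pseudo-polynomial, the principal
    ideals in Inv_u(RT, T) are generated by elements of K ([pseudo_descent]), so
    LPic_u(RT, T) is the quotient of Inv_u(RT, T) by the ideals extended from
    Inv(T) ([lclass_eq0]).

    Sharpness stratifies Theta: every T in Theta leaves the derived sequence at
    some stage, and its level is the ordinal c such that T lies in N^c and is a
    Jaffard overring of T_c ([sharp_levels]).  All that is needed about Jaffard
    overrings is a partition of unity: for every nonzero y in D one can write
    1 = e + f with e in yT and f in yT' for all the other T' of level at least
    that of T ([jaffard_splits]).  It follows that a condition on T which is
    open in the Zariski topology and holds at K, if it fails at all, has a
    highest level at which it fails, and fails only finitely often there
    ([bad_top]).  It can therefore be repaired by well-founded induction on the
    level, one overring at a time, provided that the repair at T does not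
    disturb the other T' of level at least that of T ([devissage]).

    Two repairs are made in this way.  First, finitely generated ideals can be
    glued along 1 = e + f, and so each element of Inv_u(BT, T) is the
    restriction of an element of Inv_u(B, D) that is trivial at all other T' of
    level at least that of T ([lift_invertible]).  As LPic_u(RT, T) is free,
    these restrictions have homomorphic sections LPic_u(RT, T) -> Inv_u(R, D),
    which add up to a homomorphism from the direct sum to LPic_u(R, D).  It is
    injective: among the nonzero coordinates of an element choose one of highest
    level; it is the image of the sum in LPic_u(RT, T), since the other terms
    are trivial there.  It is surjective by the second repair: an ideal I in
    Inv_u(R, D) is modified, by values of the sections and by ideals extended
    from D (lifted by the case B = D), until it is trivial at every T, and then
    it is trivial because Theta is complete ([decomposition]). *)

(** * Flatness and denominators *)

(** Flatness will be tested on the inclusion of an ideal (a, b) in its ring,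
    which has to be a linear map between modules in their own right. *)
Section TwoGenerated.
Variables (A : comNzRingType) (a b : A).

Definition ideal2_pred : {pred A^o} :=
  [pred x | `[< exists p q : A, x = p * a + q * b >]].

Lemma ideal2_closed : GRing.submod_closed ideal2_pred.
Proof.
split=> [|c x y /asboolP[p [q ->]] /asboolP[p' [q' ->]]]; apply/asboolP.
  by exists 0, 0; rewrite !mul0r addr0.
exists (c * p + p'), (c * q + q').
by rewrite /GRing.scale /= mulrDr !mulrDl !mulrA addrACA.
Qed.

HB.instance Definition _ :=
  GRing.isSubmodClosed.Build A A^o ideal2_pred
    (GRing.submod_closed_semi ideal2_closed).

Definition ideal2 : Type := {x : A^o | x \in ideal2_pred}.
HB.instance Definition _ := SubChoice.on ideal2.
HB.instance Definition _ := [SubChoice_isSubLmodule of ideal2 by <:].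

Definition ideal2_incl : ideal2 -> A^o := val.
Lemma ideal2_incl_zmod : zmod_morphism ideal2_incl. Proof. by []. Qed.
Lemma ideal2_incl_scalable : scalable ideal2_incl. Proof. by []. Qed.
HB.instance Definition _ := GRing.isZmodMorphism.Build ideal2 A^o
  ideal2_incl ideal2_incl_zmod.
HB.instance Definition _ := GRing.isScalable.Build A ideal2 A^o _
  ideal2_incl ideal2_incl_scalable.

Lemma mem_ideal2 p q : p * a + q * b \in ideal2_pred.
Proof. by apply/asboolP; exists p, q. Qed.
Definition mk_ideal2 p q : ideal2 := Sub (p * a + q * b : A^o) (mem_ideal2 p q).

(** A coefficient of [a] in an expression of [x].  It is a mere choice, but it
    is unique modulo the ideal of the [p] such that [p * a] is a multiple of
    [b]; modulo that ideal, it is therefore linear in [x]. *)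
Definition ideal2_coef (x : ideal2) : A := sval (cid (asboolW (valP x))).
Lemma ideal2_coefP (x : ideal2) :
  exists q, val x = ideal2_coef x * a + q * b :> A.
Proof. by rewrite /ideal2_coef; case: cid. Qed.
End TwoGenerated.

Section Flat.
Variable L : fieldType.
Implicit Types A T : subring L.

Lemma gensub_sub (V : zmodType) (P : set V) x : P x -> x \in gensub P.
Proof. by move=> Px; apply/asboolP => S _; apply. Qed.

Definition colon A (M : set L) (z : L) : set L := [set c | c \in A /\ M (c * z)].

(** Write t = a/b.  In the tensor product of T with A the element
    1 (x) a - t (x) b vanishes, hence it already vanishes in the tensor product
    with the ideal (a, b).  Sending u (x) (pa + qb) to the class of u * p is
    well defined modulo (A : t)T, and it maps this element to 1. *)
Lemma flat_denominators A T t :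
  flat_over A T -> t \in T -> t \in frac A ->
  setprod (colon A [set` A] t) [set` T] 1.
Proof.
move=> [AT flatT] tT /asboolP[a0 [b0 [aA bA b_neq0 tE]]].
pose a : subring_sort A := Sub a0 aA; pose b : subring_sort A := Sub b0 bA.
pose M := restrict_scalars (subring_incl AT).
pose u : M := (1 : subring_sort T); pose v : M := (Sub t tT : subring_sort T).
pose I := ideal2 a b.
pose ia : I := mk_ideal2 a b 1 0; pose ib : I := mk_ideal2 a b 0 1.
pose z : {freeg (M * I)%type / int} := << (u, ia) >> - << (v, ib) >>.
pose one : (subring_sort A)^o := 1.
have rel c w : << (c *: w, one) >> - << (w, c *: one) >> \in
    gensub (tensor_relations (M := M) (N := (subring_sort A)^o)).
  by apply: gensub_sub; constructor 3; exists c, w, one.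
have uv : a *: u = b *: v.
  by apply: val_inj; rewrite /= mulr1 tE mulrC divfK.
have z0 : \pi_(tensor M I) z = \pi_(tensor M I) 0.
  apply: (flatT _ _ (ideal2_incl (b:=b)) val_inj).
  rewrite !tensor_mapE raddf0 raddfB /= !freeg_tensor_mapU.
  apply/eqP; rewrite -Quotient.idealrBE subr0.
  suff main n1 n2 : n1 = a *: one -> n2 = b *: one ->
      << (u, n1) >> - << (v, n2) >> \in
      gensub (tensor_relations (M := M) (N := (subring_sort A)^o)).
    apply: main; apply: val_inj; rewrite /= mulr1.
      by rewrite mul1r mul0r addr0.
    by rewrite mul1r mul0r add0r.
  move=> -> ->; rewrite -(subrKA << (a *: u, one) >>) {2}uv.
  by rewrite rpredD ?rel // -opprB rpredN rel.
move/eqP: z0; rewrite -Quotient.idealrBE subr0 => /asboolP zR.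
(* [u (x) i |-> u * p], on the free group before passing to the tensor *)
pose phi (w : {freeg (M * I)%type / int}) : L := fglift (fun mi : M * I =>
  ((val (mi.1 : subring_sort T) * val (ideal2_coef mi.2)) : zmodule L)) w.
have phiU x i : phi << (x, i) >> = val (x : subring_sort T) * val (ideal2_coef i).
  by rewrite /phi liftU scale1r.
have phiB x y : phi (x - y) = phi x - phi y by
  exact: (@lift_is_additive int _ (zmodule L)).
pose C := setprod (colon A [set` A] t) [set` T].
have CN x : C x -> C (- x).
  move=> Cx; apply: (@setprod_ind _ _ _ [set x | C (- x)]) Cx => /=.
  - by rewrite oppr0; exact: setprod0.
  - by move=> p q Cp Cq; rewrite opprD; exact: setprodD.
  - by move=> p q Cp Cq; rewrite -mulrN; apply: mem_setprod; rewrite //= rpredN.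
have CB x y : C x -> C y -> C (x - y).
  by move=> Cx /CN; exact: setprodD.
have coefP (i : I) : exists2 r, r \in A &
    val (val i) = val (ideal2_coef i) * a0 + r * b0.
  by have [r /(congr1 val) E] := ideal2_coefP i; exists (val r); first exact: valP.
have colonP k r p q : k \in A -> r \in A -> p \in A -> q \in A ->
    k * a0 + r * b0 = p * a0 + q * b0 -> colon A [set` A] t (k - p).
  move=> kA rA pA qA E; split; first by rewrite rpredB.
  suff -> : (k - p) * t = q - r by rewrite /= rpredB.
  rewrite tE mulrA; apply: (mulIf b_neq0); rewrite divfK // !mulrBl.
  apply/eqP; rewrite subr_eq addrAC eq_sym subr_eq E.
  by rewrite [X in X == _]addrC.
have coef1 (i : I) (p q : L) : p \in A -> q \in A ->
    val (val i) = p * a0 + q * b0 -> colon A [set` A] t (val (ideal2_coef i) - p).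
  have [r rA ->] := coefP i => pA qA; apply: colonP => //; exact: valP.
have coefB (i k l : I) (c d : L) : c \in A -> d \in A ->
    val (val i) = c * val (val k) + d * val (val l) -> colon A [set` A] t
     (val (ideal2_coef i) - (c * val (ideal2_coef k) + d * val (ideal2_coef l))).
  have [ri riA ->] := coefP i; have [rk rkA ->] := coefP k.
  have [rl rlA ->] := coefP l => cA dA E.
  apply: (colonP _ ri _ (c * rk + d * rl)); rewrite ?rpredD ?rpredM //;
    try exact: valP.
  by rewrite E !mulrDr !mulrDl !mulrA addrACA.
have CT w (x : L) : colon A [set` A] t w -> x \in T -> C (x * w).
  by move=> Dw xT; rewrite mulrC; exact: mem_setprod.
have Cz : C (phi z).
  suff /asboolP : z \in [pred w | `[< C (phi w) >]] by [].
  apply: zR => [|w Rw]; first split; first apply/asboolP.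
  - have -> : phi 0 = 0 by rewrite -(subrr 0) phiB subrr.
    exact: setprod0.
  - by move=> x y /asboolP Cx /asboolP Cy; apply/asboolP; rewrite phiB; exact: CB.
  apply/asboolP.
  case: Rw => [[m [m' [n ->]]]|[m [n [n' ->]]]|[c [m [n ->]]]];
    rewrite !phiB !phiU /=.
  - rewrite -!mulrBl [_ + _ - _]addrAC addrK subrr mul0r; exact: setprod0.
  - rewrite -mulrBr -mulrBr -addrA -opprD; apply: CT; last exact: valP.
    have := coefB (n + n') n n' 1 1; rewrite !mul1r.
    by apply; rewrite ?rpred1.
  - rewrite mulrAC [_ * \val m]mulrC -mulrBr -opprB mulrN.
    apply/CN/CT; last exact: valP.
    have := coefB (c *: n) n n (val c) 0; rewrite !mul0r !addr0; apply=> //.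
      exact: valP.
    exact: rpred0.
rewrite phiB !phiU /= mul1r in Cz *.
have Ca : colon A [set` A] t (val (ideal2_coef ia) - 1).
  by apply: (coef1 ia 1 0); rewrite ?rpred1 ?rpred0 //= mul1r mul0r.
have Cb : colon A [set` A] t (val (ideal2_coef ib) - 0).
  by apply: (coef1 ib 0 1); rewrite ?rpred1 ?rpred0 //= mul1r mul0r.
have := CB _ _ (setprodD Cz (CT _ _ Cb tT)) (CT _ _ Ca (rpred1 T)).
by rewrite subr0 mul1r subrK subKr.
Qed.
End Flat.

(** * Localizing at a flat overring *)

Section Local.
Variable L : fieldType.
Implicit Types (A D S T : subring L) (M I : set L).

Lemma subring_anti A T : {subset A <= T} -> {subset T <= A} -> A = T.
Proof. by move=> AT TA; apply: subring_eq => x; apply/idP/idP; auto. Qed.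

Lemma frac_id A : frac (frac A) = frac A.
Proof.
apply: subring_anti => x; last exact: sub_frac.
by move=> /asboolP[a [b [aA bA _ ->]]]; rewrite rpredM ?frac_inv.
Qed.

Lemma frac_overring A T : overring A T -> frac T = frac A.
Proof.
move=> [AT TF]; apply: subring_anti; last exact: fracS.
by move=> x /(fracS TF); rewrite frac_id.
Qed.

Lemma submodule_ring A T : {subset A <= T} -> submodule A [set` T].
Proof.
move=> AT; split=> [|x y|a x aA] /=; [exact: rpred0|exact: rpredD|].
exact/rpredM/AT.
Qed.

Lemma mem_ext M T x : M x -> setprod M [set` T] x.
Proof. by move=> Mx; rewrite -[x]mulr1; apply: mem_setprod; rewrite //= rpred1. Qed.

Lemma submoduleM A M I : submodule A M -> submodule A (setprod M I).
Proof.
move=> [M0 MD MA]; split; [exact: setprod0|exact: setprodD|move=> a x aA].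
apply: (@setprod_ind _ _ _ [set x | setprod M I (a * x)]) => /=.
- by rewrite mulr0; exact: setprod0.
- by move=> u v uP vP; rewrite mulrDr; exact: setprodD.
- by move=> u v Mu Iv; rewrite mulrA; apply: mem_setprod => //; exact: MA.
Qed.

Lemma submodule_ext M T : submodule T (setprod M [set` T]).
Proof. by rewrite setprodC; exact/submoduleM/submodule1. Qed.

Lemma submoduleS A T M : {subset A <= T} -> submodule T M -> submodule A M.
Proof. by move=> AT [M0 MD MT]; split=> // a x /AT; exact: MT. Qed.

Lemma submodule_mulr A M a x : submodule A M -> a \in A -> M x -> M (x * a).
Proof. by move=> [_ _ MA] aA Mx; rewrite mulrC; exact: MA. Qed.

Lemma setprod_sub_module A M I :
  submodule A M -> I `<=` M -> setprod I [set` A] `<=` M.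
Proof.
move=> MM IM; have [M0 MD _] := MM; apply: setprod_ind => // x a /IM Mx aA.
exact: (submodule_mulr MM).
Qed.

(** The product of two ideals is contained in their intersection. *)
Lemma unit_ext_meet A T I J : {subset A <= T} -> integral_ideal A I ->
  integral_ideal A J -> setprod I [set` T] 1 -> setprod J [set` T] 1 ->
  setprod (I `&` J) [set` T] 1.
Proof.
move=> AT [[I0 ID IM] IA] [[J0 JD JM] JA] I1 J1.
have := mem_setprod I1 J1; rewrite mulr1 setprod_ext.
apply: setprodS => //; apply: setprod_ind => [//|x y [Ix Jx] [Iy Jy]|x y Ix Jy].
  by split; [exact: ID|exact: JD].
by split; [rewrite mulrC; apply: IM; first exact: JA|apply: JM; first exact: IA].
Qed.

Lemma colon_ideal A M z : submodule A M -> integral_ideal A (colon A M z).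
Proof.
move=> [M0 MD MA]; split=> [|c []//]; split=> [|c d [cA Mc] [dA Md]|a c aA [cA Mc]].
- by split; rewrite ?rpred0 ?mul0r.
- by split; [rewrite rpredD|rewrite mulrDl; exact: MD].
- by split; [rewrite rpredM|rewrite -mulrA; exact: MA].
Qed.

(** The classical description of flat overrings by denominator ideals. *)
Definition denominator_flat A T : Prop :=
  forall t, t \in T -> setprod (colon A [set` A] t) [set` T] 1.

(** If z is the sum of the m_i t_i, every common denominator of the t_i brings z
    into M. *)
Lemma flat_colon A T M z : {subset A <= T} -> denominator_flat A T ->
  submodule A M -> setprod M [set` T] z ->
  setprod (colon A M z) [set` T] 1.
Proof.
move=> AT flatT MM; have [M0 MD MA] := MM; move: z.
apply: (@setprod_ind _ _ _ [set z | setprod (colon A M z) [set` T] 1]) => /=.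
- by apply: mem_ext; split; rewrite ?rpred1 ?mulr0.
- move=> x y xM yM; have := unit_ext_meet AT (colon_ideal _ MM)
    (colon_ideal _ MM) xM yM.
  by apply: setprodS => // c [[cA cx] [_ cy]]; split; rewrite ?mulrDr //; exact: MD.
- move=> x t Mx tT; apply: setprodS (flatT t tT) => // c [cA ct]; split=> //.
  by rewrite mulrCA; exact: (submodule_mulr MM).
Qed.

(** By flatness, the conductor of z into M is an ideal which is not proper at
    any T, so that completeness forces it to contain 1. *)
Lemma local_global A Th M z : complete_family A Th ->
  (forall T, Th T -> {subset A <= T} /\ denominator_flat A T) -> submodule A M ->
  (forall T, Th T -> setprod M [set` T] z) -> M z.
Proof.
move=> Thc Thf MM Mz; have := Thc _ (colon_ideal z MM).
move/seteqP => -[_ /(_ 1)] -[|_]; last by rewrite mul1r.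
split; first exact: rpred1.
by move=> T ThT; have [AT fT] := Thf T ThT; exact: flat_colon (Mz T ThT).
Qed.

Lemma flat_overrings_denominator A Th : flat_overrings A Th ->
  forall T, Th T -> {subset A <= T} /\ denominator_flat A T.
Proof.
move=> Thf T ThT; have [[AT TF] fT] := Thf T ThT; split=> // t tT.
by apply: flat_denominators => //; exact: TF.
Qed.

Lemma complete_self A Th : complete_family A Th ->
  (forall T, Th T -> {subset A <= T}) ->
  forall x, x \in frac A -> (forall T, Th T -> x \in T) -> x \in A.
Proof.
move=> Thc AT x xF xT.
have [_] := (seteqP _ _).1 (Thc _ (conj (submodule1 A) (@subset_refl _ _))).
by apply; split=> // T ThT; rewrite setprod_sub //=; [exact: xT|exact: AT].
Qed.

(** * Splitting off a Jaffard overring *)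

(** The ideals of the e with e/y in T and of the f with f/y in all the other
    members are together comaximal, because this can be checked at each member:
    the first one is the unit ideal at S <> T because TS = K, and the second one
    is the unit ideal at T because, by local finiteness, it is cut out by
    finitely many conditions, each of the same kind. *)
Lemma jaffard_partition A Lam T y : jaffard_family A Lam -> Lam T ->
  y \in A -> y != 0 -> exists e f, [/\ e \in A, f \in A, e + f = 1,
    e / y \in T & forall S, Lam S -> S <> T -> f / y \in S].
Proof.
move=> [Lf Lc Li Ll _] LT yA y0; have Lr := flat_overrings_denominator Lf.
have sub S : Lam S -> {subset A <= S} by move=> /Lr[].
pose E S : set L := colon A [set` S] y^-1.
have Eid S : Lam S -> integral_ideal A (E S).
  by move=> LS; apply/colon_ideal/submodule_ring/sub.
have E1 S S' : Lam S -> Lam S' -> S <> S' -> setprod (E S) [set` S'] 1.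
  move=> LS LS' SS'; apply: flat_colon; [exact: sub|by case: (Lr S')| |].
    exact/submodule_ring/sub.
  have : y^-1 \in compositum S S' by rewrite Li // frac_inv // sub_frac.
  by move/asboolP.
pose F (P : set (subring L)) : set L :=
  [set f | f \in A /\ forall S, P S -> f / y \in S].
have Fid P : P `<=` Lam -> integral_ideal A (F P).
  move=> PL; split=> [|c []//]; split=> [|c d [cA Sc] [dA Sd]|a c aA [cA Sc]].
  - by split=> [|S _]; rewrite ?mul0r rpred0.
  - by split=> [|S PS]; rewrite ?mulrDl rpredD ?Sc ?Sd.
  - by split=> [|S PS]; rewrite -?mulrA rpredM ?Sc // (sub S) //; exact: PL.
have /finite_seqP[l lE] := Ll y yA y0.
(* The members outside [l] contain 1/y, so only those in [l] matter. *)
have F1 : setprod (F [set S | Lam S /\ S <> T]) [set` T] 1.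
  suff : setprod (F [set S | [/\ S \in l, Lam S & S <> T]]) [set` T] 1.
    apply: setprodS => // c [cA cl]; split=> // S [LS ST].
    have [Sl|Sl] := boolP (S \in l); first exact: cl.
    apply: rpredM; first exact: (sub S).
    have : ~ [set` l] S by move/negP: Sl.
    rewrite -lE => /not_andP[//|/contrapT[y' y'S yy']].
    suff -> : y^-1 = y' by [].
    by apply: (mulfI y0); rewrite divff.
  elim: l {lE} => [|S l IH].
    by apply: mem_ext; split=> [|S []] //; exact: rpred1.
  have [[LS ST]|NS] := pselect (Lam S /\ S <> T); last first.
    apply: setprodS IH => // c [cA cl]; split=> // S' [+ LS' S'T].
    by rewrite inE => /orP[/eqP S'S|S'l]; [case: NS; rewrite -S'S|exact: cl].
  have := unit_ext_meet (sub T LT) (Fid _ _) (Eid S LS) IH (E1 S T LS LT ST).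
  move=> FS; apply: setprodS (FS _) => [c [[cA cl] [_ cS]]|//|S' []//].
  split=> // S' [+ LS' S'T]; rewrite inE => /orP[/eqP->//|S'l].
  exact: cl.
pose O := [set S | Lam S /\ S <> T].
pose H : set L := [set z | exists e f, [/\ E T e, F O f & z = e + f]].
have [[E0 ED EM] EA] := Eid T LT.
have [[F0 FD FM] FA] := Fid O (@subIsetl _ _ _).
have HH : submodule A H.
  split; first by exists 0, 0; rewrite addr0.
    move=> _ _ [e [f [Ee Ff ->]]] [e' [f' [Ee' Ff' ->]]].
    by exists (e + e'), (f + f'); rewrite addrACA; split; [exact: ED|exact: FD|].
  move=> a _ aA [e [f [Ee Ff ->]]]; exists (a * e), (a * f).
  by rewrite mulrDr; split; [exact: EM|exact: FM|].
have [e [f [[eA eT] [fA fS] ef]]] : H 1.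
  apply: (local_global Lc Lr HH) => S LS.
  have [->|ST] := pselect (S = T).
    by apply: setprodS F1 => // f Ff; exists 0, f; rewrite add0r.
  apply: setprodS (E1 T S LT LS (nesym ST)) => // e Ee.
  by exists e, 0; rewrite addr0.
by exists e, f; split=> // S LS ST; exact: fS.
Qed.
End Local.

Section Levels.
Variable L : fieldType.
Implicit Types (A D S T : subring L) (N Th : set (subring L)).

(** The trace on N of the fact that T is a Jaffard overring: T is separated from
    the rest of N by partitions of unity that vanish to arbitrary depth. *)
Definition splits D N T : Prop := forall y, y \in D -> y != 0 ->
  exists e f, [/\ e + f = 1, e / y \in T &
                  forall T', N T' -> T' <> T -> f / y \in T'].

(** The element f/y given by [jaffard_partition] lies in every member of the
    Jaffard family other than T, and must be shown to lie in T'.  Since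
    TT' = K, flatness gives elements c of D that generate the unit ideal in T'
    and multiply f/y into T.  Then c * (f/y) lies in all the members of the
    Jaffard family, hence in A, hence in T'. *)
Lemma jaffard_splits D Th A N T : pre_jaffard_family D Th -> overring D A ->
  N `<=` Th -> (forall T', N T' -> {subset A <= T'}) -> N T ->
  jaffard_overring A T -> splits D N T.
Proof.
move=> [Thf Thc Thi _ _] DA NTh AN NT [Lam LJ LT] y yD y0.
have [DsA AF] := DA; have fracA : frac A = frac D := frac_overring DA.
have Thr := flat_overrings_denominator Thf.
have [e [f [eA fA ef eT fS]]] := jaffard_partition LJ LT (DsA y yD) y0.
exists e, f; split=> // T' NT' T'T.
have [DT' rT'] := Thr T' (NTh _ NT').
have fyF : f / y \in frac D.
  by rewrite rpredM //; [exact: AF|exact/frac_inv/sub_frac].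
have : setprod [set` T] [set` T'] (f / y).
  suff /asboolP : f / y \in compositum T T' by [].
  by rewrite Thi //; [exact: NTh|exact: NTh|exact: nesym].
move/(flat_colon DT' rT' (submodule_ring (Thr T (NTh _ NT)).1)) => C1.
have C1' : setprod (colon D [set` T'] (f / y)) [set` T'] 1.
  apply: setprodS C1 => // c [cD cT]; split=> //=; apply: (AN T' NT').
  have [Lf Lc _ _ _] := LJ.
  have Lsub S : Lam S -> {subset A <= S} by move=> /Lf[[]].
  apply: (complete_self Lc Lsub).
    by rewrite fracA rpredM // sub_frac.
  move=> S LS; have [->//|ST] := pselect (S = T).
  by rewrite rpredM ?fS //; apply: Lsub => //; exact: DsA.
suff : setprod (colon D [set` T'] (f / y)) [set` T'] `<=`
    [set x | x * (f / y) \in T'] by move/(_ _ C1') => /=; rewrite mul1r.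
apply: setprod_ind => [|u v|c t [cD cT] tT'] /=.
- by rewrite mul0r rpred0.
- by move=> uT vT; rewrite mulrDl rpredD.
- by rewrite mulrAC rpredM.
Qed.

Lemma wo_trans (W : Type) (le : rel W) : wochoice.well_order le ->
  forall x y z, le x y -> le y z -> le x z.
Proof.
move=> wo x y z xy yz.
have [|m [->|[->|->]] mmin] :=
    wo_min wo (P := [set w | w = x \/ (w = y \/ w = z)]).
- by exists x; left.
- by apply: mmin; right; right.
- by rewrite (wo_anti wo xy (mmin x _)) //; left.
- have zy : le z y by apply: mmin; right; left.
  by rewrite -(wo_anti wo yz zy).
Qed.

(** The level of T is the predecessor of the first stage b with T not in N^b.
    This stage exists because N^a is empty as soon as T_a = K, and it is neither
    zero nor a limit by the definition of the N^b there. *)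
Lemma sharp_levels D Th : pre_jaffard_family D Th -> sharp D Th ->
  exists (W : Type) (le : rel W) (lev : subring L -> W),
    wochoice.well_order le /\
    forall T, Th T -> splits D [set T' | Th T' /\ le (lev T) (lev T')] T.
Proof.
move=> ThJ [W [le [N [TT [a [wo der TTa]]]]]]; have [Thf Thc _ _ KTh] := ThJ.
have NTh c : N c `<=` Th.
  elim/(well_founded_ind (ord_lt_wf wo)): c => c IH.
  have [z s l _] := der c; have [c0|c0] := pselect (ord_zero le c).
    by rewrite (z c0).1.
  have [[d dc]|nosucc] := pselect (exists d, ord_succ le d c).
    by rewrite (s d dc) => T [NT _]; apply: IH NT; case: dc.
  rewrite l; last by split=> // d dc; apply: nosucc; exists d.
  move=> T NT; apply: contrapT => NThT; apply: c0 => d dc.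
  by apply: NThT; apply: (IH d dc); exact: NT.
have TTover c : overring D (TT c) /\
    (forall T, Th T -> N c T -> {subset TT c <= T}).
  have [z _ _ nz] := der c; have [c0|c0] := pselect (ord_zero le c).
    have [_ ->] := z c0; split; first by split=> //; exact: sub_frac.
    by move=> T /Thf[[]].
  rewrite (nz c0); split=> [|T _ NT x /asboolP[_]]; last exact.
  split=> [x xD|x /asboolP[]//]; apply/asboolP; split=> [|T NT]; first exact: sub_frac.
  by have [[+ _] _] := Thf T (NTh _ _ NT); apply.
have Na T : Th T -> ~ N a T.
  move=> ThT NaT; apply: KTh; suff <- : T = frac D by [].
  apply: subring_anti; first by have [[]] := Thf T ThT.
  by rewrite -TTa; exact: (TTover a).2.
have lev_ex T : exists c, Th T ->
    [/\ forall b, le b c -> N b T & jaffard_overring (TT c) T].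
  have [ThT|] := pselect (Th T); last by exists a.
  have [|b NbT bmin] := wo_min wo (P := [set b | ~ N b T]).
    by exists a; exact: Na.
  have below c : ord_lt le c b -> N c T.
    by move=> cb; apply: contrapT => /bmin; exact/negP.
  have [z s l _] := der b.
  have b0 : ~ ord_zero le b by move=> b0; apply: NbT; rewrite (z b0).1.
  have [[c cb]|nosucc] := pselect (exists c, ord_succ le c b); last first.
    case: NbT; rewrite l //; first by split=> // c cb; apply: nosucc; exists c.
  have [cltb _] := cb; exists c => _; split=> [d dc|].
    apply: below; apply/negP => bd.
    by have := cltb; rewrite /ord_lt (wo_trans wo bd dc).
  apply: contrapT => NJ; apply: NbT; rewrite (s c cb); split=> //.
  exact: below.
have [lev levP] := choice lev_ex.
exists W, le, lev; split=> // T ThT.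
have [NT JT] := levP T ThT; have [over sub] := TTover (lev T).
have refl c : le c c by case: (wo_total wo c c).
apply: (jaffard_splits ThJ over) => //; first by move=> T' [].
  move=> T' [ThT' leTT']; apply: sub => //.
  by have [NT' _] := levP T' ThT'; exact: NT'.
Qed.
End Levels.

(** * Compactness and induction on the level *)

(** A base point is required for passing from compactness to finite covers. *)
HB.instance Definition _ (L : fieldType) (A : subring L) :=
  isPointed.Build (overrings A)
    (exist _ A (asboolT (conj (fun x => id) (@sub_frac L A)) : `[< overring A A >])).

Section Devissage.
Variable L : fieldType.
Implicit Types (A D S T : subring L) (Th : set (subring L)).

Lemma overrings_open A x : x \in frac A ->
  open [set T : overrings A | x \in sval T].
Proof.
move=> xF; exists [set [set T : overrings A | x \in sval T]].
  by move=> _ ->; apply: finI_from1; exists x.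
by rewrite bigcup_set1.
Qed.

Lemma compact_finite A Th (F : subring L -> seq L) :
  compact [set T : overrings A | Th (sval T)] ->
  (forall T, Th T -> overring A T) -> (forall T, Th T -> {subset F T <= T}) ->
  exists2 l : seq (subring L), forall T, T \in l -> Th T &
    forall T', Th T' -> exists2 T, T \in l & {subset F T <= T'}.
Proof.
rewrite compact_cover => cpt over FT.
pose U T : set (overrings A) :=
    [set T' : overrings A | {subset F T <= sval T'}].
have Uopen T : Th T -> open (U T).
  move=> ThT; have : {subset F T <= frac A} by move=> x /(FT T ThT)/(over T ThT).2.
  rewrite /U; elim: (F T) => [|x s IH] sF.
    have -> : [set T' : overrings A | {subset [::] <= sval T'}] = setT.
      by apply/seteqP; split.
    exact: openT.
  have -> : [set T' : overrings A | {subset x :: s <= sval T'}] =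
    [set T' : overrings A | x \in sval T'] `&`
    [set T' : overrings A | {subset s <= sval T'}].
    apply/seteqP; split=> T' /=.
      by move=> sT'; split=> [|y ys]; apply: sT'; rewrite inE ?eqxx ?ys ?orbT.
    by move=> [xT' sT'] y; rewrite inE => /orP[/eqP->|/sT'].
  apply: openI; first by apply/overrings_open/sF; rewrite mem_head.
  by apply: IH => y ys; apply: sF; rewrite inE ys orbT.
have [||l lTh cover] := cpt _ Th U.
- exact: Uopen.
- by move=> T' /= ThT'; exists (sval T'); [|exact: FT].
exists (finmap.enum_fset l) => [T Tl|T' ThT'].
  by have := lTh T Tl; rewrite inE.
have T'o : `[< overring A T' >] by apply/asboolP/over.
have [T Tl UT] := cover (exist _ T' T'o) ThT'.
by exists T.
Qed.

(** Openness for the Zariski topology, for conditions on arbitrary subrings; the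
    value of the condition at K, which is not in the family, will be used. *)
Definition zariski_open (P : subring L -> Prop) : Prop :=
  forall T, P T -> exists2 F : seq L, {subset F <= T} &
    forall T', {subset F <= T'} -> P T'.

Lemma common_denominator D (s : seq L) : {subset s <= frac D} ->
  exists x, [/\ x \in D, x != 0 & forall a, a \in s -> x * a \in D].
Proof.
elim: s => [|a s IH] sF; first by exists 1; rewrite rpred1 oner_eq0.
have [|x [xD x0 xs]] := IH; first by move=> b bs; apply: sF; rewrite inE bs orbT.
have /asboolP[c [d [cD dD d0 aE]]] := sF a (mem_head _ _).
exists (x * d); split; [exact: rpredM|by rewrite mulf_neq0|move=> b].
rewrite inE => /orP[/eqP->|/xs xb].
  by rewrite aE -mulrA [d * _]mulrC divfK // rpredM.
by rewrite mulrAC rpredM.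
Qed.

(** The finitely many elements of K that witness the condition at K have a
    common denominator x. *)
Lemma zariski_open_generic D P : zariski_open P -> P (frac D) ->
  exists x, [/\ x \in D, x != 0 &
    forall T, {subset D <= T} -> x^-1 \in T -> P T].
Proof.
move=> Po /Po[F FK PF]; have [x [xD x0 xF]] := common_denominator FK.
exists x; split=> // T DT xT; apply: PF => a /xF /DT xa.
by rewrite -(mulKf x0 a) rpredM.
Qed.

Variables (D : subring L) (Th : set (subring L)) (W : Type) (le : rel W).
Variable lev : subring L -> W.
Hypothesis wo : wochoice.well_order le.
Hypothesis over : forall T, Th T -> overring D T.
Hypothesis cpt : compact [set T : overrings D | Th (sval T)].
Hypothesis lev_splits : forall T, Th T ->
  splits D [set T' | Th T' /\ le (lev T) (lev T')] T.

Lemma exists_top (B : set (subring L)) (l : seq (subring L)) T0 :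
  B T0 -> T0 \in l -> exists T, [/\ B T, T \in l &
    forall T', B T' -> T' \in l -> le (lev T') (lev T)].
Proof.
elim: l T0 => // S l IH T0 BT0 T0l.
have rfl c : le c c by case: (wo_total wo c c).
have [[T1 [BT1 T1l]]|none] := pselect (exists T1, B T1 /\ T1 \in l); last first.
  exists T0; split=> // T' BT' T'l; move: T0l T'l.
  have out T'' : B T'' -> T'' \in S :: l -> T'' = S.
    by move=> BT''; rewrite inE => /orP[/eqP//|T''l]; case: none; exists T''.
  by move=> /out-> // /out->.
have [T [BT Tl Tmax]] := IH T1 BT1 T1l.
have [[BS TS]|NS] := pselect (B S /\ le (lev T) (lev S)).
  exists S; rewrite mem_head; split=> // T' BT'.
  rewrite inE => /orP[/eqP->//|T'l].
  exact: (wo_trans wo (Tmax T' BT' T'l)).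
exists T; rewrite inE Tl orbT; split=> // T' BT'.
rewrite inE => /orP[/eqP T'S|]; last exact: Tmax.
subst T'; case: (wo_total wo (lev S) (lev T)) => // TS; by case: NS.
Qed.

(** Choose x as in [zariski_open_generic], and for each bad T a partition
    1 = e + f of depth x.  A bad T' that contains e/x is T or has lower level
    than T, since otherwise it would contain 1/x = e/x + f/x.  By compactness,
    finitely many of these neighbourhoods contain all the bad overrings. *)
Lemma bad_top (P : subring L -> Prop) T0 :
  zariski_open P -> P (frac D) -> Th T0 -> ~ P T0 ->
  exists d (l : seq (subring L)), [/\ exists T, [/\ Th T, ~ P T & lev T = d],
    forall T, Th T -> ~ P T -> le (lev T) d &
    forall T, Th T -> ~ P T -> le d (lev T) -> T \in l].
Proof.
move=> Po PK ThT0 PT0; have [x [xD x0 xP]] := zariski_open_generic Po PK.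
have /choice[F0 F0P] T : exists F : seq L, Th T -> {subset F <= T} /\
    forall T', Th T' -> {subset F <= T'} -> ~ P T' ->
    ~ P T /\ (T' = T \/ ~ le (lev T) (lev T')).
  have [ThT|] := pselect (Th T); last by exists [::].
  have [PT|PT] := pselect (P T).
    by have [F FT FP] := Po T PT; exists F => _; split=> // T' _ /FP.
  have [e [f [ef eT fT']]] := lev_splits ThT xD x0.
  exists [:: e / x] => _; split=> [a|T' ThT' eT' PT'].
    by rewrite inE => /eqP->.
  split=> //; have [->|T'T] := pselect (T' = T); first by left.
  right=> leTT'; apply: PT'; apply: xP; first by case: (over ThT').
  rewrite -[x^-1]mul1r -ef mulrDl rpredD ?fT' //.
  by apply: eT'; rewrite mem_head.
have [|l lTh lcov] := compact_finite cpt over (F := F0).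
  by move=> T /F0P[].
have [T1 T1l FT1] := lcov T0 ThT0.
have [PT1 _] := (F0P _ (lTh _ T1l)).2 _ ThT0 FT1 PT0.
have [T [PT Tl Tmax]] := exists_top (B := [set T | ~ P T]) PT1 T1l.
exists (lev T), l; split; first by exists T; split=> //; exact: lTh.
  move=> T' ThT' PT'; have [S Sl FS] := lcov T' ThT'.
  have [PS [->|NS]] := (F0P _ (lTh _ Sl)).2 _ ThT' FS PT'; first exact: Tmax.
  apply: (wo_trans wo _ (Tmax S PS Sl)).
  by case: (wo_total wo (lev S) (lev T')).
move=> T' ThT' PT' leTT'; have [S Sl FS] := lcov T' ThT'.
have [PS [->//|[]]] := (F0P _ (lTh _ Sl)).2 _ ThT' FS PT'.
exact: (wo_trans wo (Tmax S PS Sl)).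
Qed.

(** The induction is on the highest level at which [P p] fails and, within a
    level, on a list of the overrings where it fails. *)
Lemma devissage (X : Type) (P : X -> subring L -> Prop) (Q : X -> Prop) :
  (forall p, Q p -> zariski_open (P p)) -> (forall p, Q p -> P p (frac D)) ->
  (forall p T, Q p -> Th T -> ~ P p T -> exists p', [/\ Q p', P p' T &
     forall T', Th T' -> le (lev T) (lev T') -> T' <> T -> P p T' -> P p' T']) ->
  forall p, Q p -> exists2 p', Q p' & forall T, Th T -> P p' T.
Proof.
move=> Po PK step.
have start p : Q p -> (forall T, Th T -> P p T) \/
  exists d (l : seq (subring L)), [/\ exists T, [/\ Th T, ~ P p T & lev T = d],
    forall T, Th T -> ~ P p T -> le (lev T) d &
    forall T, Th T -> ~ P p T -> le d (lev T) -> T \in l].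
  move=> Qp; have [|/existsNP[T /not_implyP[ThT PT]]] :=
    pselect (forall T, Th T -> P p T); first by left.
  by right; exact: (bad_top (Po p Qp) (PK p Qp) ThT PT).
suff main d (l : seq (subring L)) p : Q p ->
    (forall T, Th T -> ~ P p T -> le (lev T) d) ->
    (forall T, Th T -> ~ P p T -> le d (lev T) -> T \in l) ->
    exists2 p', Q p' & forall T, Th T -> P p' T.
  move=> p Qp; have [Pp|[d [l [_ pd pl]]]] := start p Qp; first by exists p.
  exact: (main d l p Qp pd pl).
elim/(well_founded_ind (ord_lt_wf wo)): d l p => d IHd.
elim=> [|T l IHl] p Qp pd pl.
  have [Pp|[d' [l' [[T [ThT PT <-]] pd' pl']]]] := start p Qp; first by exists p.
  by apply: IHd pd' pl' => //; apply/negP => /(pl T ThT PT).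
have [[ThT PT]|NT] := pselect (Th T /\ ~ P p T); last first.
  apply: IHl pd _ => // T' ThT' PT' dT'; have := pl T' ThT' PT' dT'.
  by rewrite inE => /orP[/eqP T'T|//]; case: NT; rewrite -T'T.
have [p' [Qp' PT' keep]] := step p T Qp ThT PT.
have Td := pd T ThT PT.
have old T' : Th T' -> ~ P p' T' -> le d (lev T') -> T' <> T /\ ~ P p T'.
  move=> ThT' NPT' dT'; have T'T : T' <> T by move=> T'T; rewrite T'T in NPT'.
  by split=> // PT''; apply: NPT'; apply: keep => //; exact: (wo_trans wo Td).
apply: (IHl p' Qp') => T' ThT' NPT'.
  case: (wo_total wo (lev T') d) => // dT'.
  by apply: pd => //; case: (old T' ThT' NPT' dT').
move=> dT'; have [T'T] := old T' ThT' NPT' dT'.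
by move=> /pl; rewrite inE => /(_ ThT' dT')/orP[/eqP|].
Qed.
End Devissage.

(** * Prescribing an invertible ideal at one member of the family *)

Section Lifting.
Variable L : fieldType.
Implicit Types (A B C D S T : subring L) (M I J : set L) (s : seq L).

Definition span B s : set L := setprod [set` s] [set` B].

(** For an invertible ideal of B, this is membership in Inv_u(B, D): see
    [invu_predP]. *)
Definition commensurable D B M : Prop :=
  exists x, [/\ x \in D, x != 0, M x & forall z, M z -> x * z \in B].

Lemma compositumE B T : [set` compositum B T] = setprod [set` B] [set` T].
Proof. by apply/seteqP; split=> x /=; [move/asboolP|move=> ?; apply/asboolP]. Qed.

Lemma span_module B s : submodule B (span B s).
Proof. exact: submodule_ext. Qed.

Lemma mem_span B s a : a \in s -> span B s a.
Proof. by move=> sa; apply: mem_ext. Qed.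

Lemma span_sub B s M : submodule B M -> (forall a, a \in s -> M a) ->
  span B s `<=` M.
Proof. by move=> MM sM; apply: setprod_sub_module => // a /sM. Qed.

Lemma span_ext_sub B s T M : submodule B M -> submodule T M ->
  (forall a, a \in s -> M a) -> setprod (span B s) [set` T] `<=` M.
Proof.
by move=> MB MT sM; apply: setprod_sub_module => //; exact: span_sub.
Qed.

Lemma span1 B : span B [:: 1] = [set` B].
Proof.
apply/seteqP; split.
  by apply: span_sub (submodule1 B) _ => a; rewrite inE => /eqP->; exact: rpred1.
move=> b bB; rewrite -[b]mulr1; case: (span_module B [:: 1]) => _ _; apply=> //.
by apply: mem_span; rewrite mem_head.
Qed.

Lemma commensurable1 D B : commensurable D B [set` B].
Proof.
exists 1; rewrite !rpred1 oner_eq0; split=> // [|z zB].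
  exact: rpred1.
by rewrite mul1r.
Qed.

(** Over BT, e * a is a multiple of x for every a in s1 or s2, and x belongs to
    both ideals.  So, modulo x, the generators f * a = a - e * a become the
    elements of s1, and the generators e * b vanish. *)
Lemma glue_at B T s1 s2 s e f x : e + f = 1 -> x != 0 -> x \in T ->
  e / (x * x) \in T -> span B s1 x -> (forall a, a \in s1 -> x * a \in B) ->
  (forall a, a \in s2 -> x * a \in B) ->
  (forall a, a \in s1 -> f * a \in s) -> x \in s ->
  (forall a, a \in s -> [\/ exists2 b, b \in s1 & a = f * b,
                           exists2 b, b \in s2 & a = e * b | a = x]) ->
  setprod (span B s) [set` T] = setprod (span B s1) [set` T].
Proof.
move=> ef x0 xT eT s1x s1B s2B s1s xs sP.
have small a : x * a \in B -> e * a = e / (x * x) * (x * a * x).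
  by move=> _; rewrite [x * a * x]mulrAC mulrA divfK // mulf_neq0.
have eT' : e \in T.
  by rewrite -(divfK (mulf_neq0 x0 x0) e); apply: rpredM => //; exact: rpredM.
have fT : f \in T by rewrite -(addKr e f) ef rpredD ?rpredN ?rpred1.
have modB u : submodule B (setprod (span B u) [set` T]).
  exact/submoduleM/span_module.
have modT u : submodule T (setprod (span B u) [set` T]) by exact: submodule_ext.
have [_ D1 B1] := modB s1; have [_ _ T1] := modT s1.
have [_ D2 B2] := modB s; have [_ _ T2] := modT s.
apply/seteqP; split; apply: span_ext_sub => // a.
  case/sP => [[b bs ->]|[b bs ->]|->]; last exact: mem_ext.
    by apply: T1 => //; apply/mem_ext/mem_span.
  rewrite small ?s2B //; apply: T1 => //; apply: B1; first exact: s2B.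
  exact: mem_ext.
move=> as1; rewrite -[a]mul1r -ef mulrDl; apply: D2.
  rewrite small ?s1B //; apply: T2 => //; apply: B2; first exact: s1B.
  exact/mem_ext/mem_span.
exact/mem_ext/mem_span/s1s.
Qed.

Lemma denominator_ext B D c : {subset D <= B} ->
  setprod [set` B] [set` frac D] c ->
  exists d, [/\ d \in D, d != 0 & d * c \in B].
Proof.
move=> DB; move: c; apply: (@setprod_ind _ _ _
    [set c | exists d, [/\ d \in D, d != 0 & d * c \in B]]) => /=.
- by exists 1; rewrite rpred1 oner_eq0 mulr0 rpred0.
- move=> u v [d [dD d0 du]] [d' [d'D d'0 dv]]; exists (d * d').
  split; [exact: rpredM|exact: mulf_neq0|].
  by rewrite mulrDr mulrAC -[d * d' * v]mulrA rpredD // rpredM // DB.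
move=> b _ bB /asboolP[a [d [aD dD d0 ->]]]; exists d.
by rewrite mulrCA [d * _]mulrC divfK // rpredM // DB.
Qed.

Lemma common_denominator_ext B D s : {subset D <= B} ->
  (forall c, c \in s -> setprod [set` B] [set` frac D] c) ->
  exists d, [/\ d \in D, d != 0 & forall c, c \in s -> d * c \in B].
Proof.
move=> DB; elim: s => [|c s IH] sB; first by exists 1; rewrite rpred1 oner_eq0.
have [|d [dD d0 ds]] := IH; first by move=> a as_; apply: sB; rewrite inE as_ orbT.
have [d' [d'D d'0 d'c]] := denominator_ext DB (sB c (mem_head _ _)).
exists (d * d'); split; [exact: rpredM|exact: mulf_neq0|move=> a].
rewrite inE => /orP[/eqP->|/ds da]; first by rewrite -mulrA rpredM // DB.
by rewrite mulrAC rpredM // DB.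
Qed.

Lemma commensurable_span D B s y : {subset D <= B} -> y \in D -> y != 0 ->
  span B s y -> (forall a, a \in s -> setprod [set` B] [set` frac D] a) ->
  commensurable D B (span B s).
Proof.
move=> DB yD y0 sy /(common_denominator_ext DB)[d [dD d0 ds]].
exists (d * y); split; rewrite ?rpredM ?mulf_neq0 //.
  by case: (span_module B s) => _ _; apply=> //; exact: DB.
apply: (@span_sub B s [set z | d * y * z \in B]) => /=.
  split=> [|u v|b z bB] /=; first by rewrite mulr0 rpred0.
    by rewrite mulrDr; exact: rpredD.
  by rewrite mulrCA; exact: rpredM.
by move=> a /ds da; rewrite mulrAC rpredM // DB.
Qed.

(** The ideal f I1 + e I2 + xB, where 1 = e + f has depth x^2: one factor x
    clears the denominators of I1 and I2, and the other one lies in both of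
    them.  At T the roles are those of [glue_at]; at the other T' the roles of e
    and f are exchanged. *)
Lemma glue D B (N : set (subring L)) T s1 s2 :
  {subset D <= B} -> overring D T ->
  (forall T', N T' -> {subset D <= T'}) -> splits D N T ->
  commensurable D B (span B s1) -> commensurable D B (span B s2) ->
  exists s, [/\ commensurable D B (span B s),
    setprod (span B s) [set` T] = setprod (span B s1) [set` T] &
    forall T', N T' -> T' <> T ->
      setprod (span B s) [set` T'] = setprod (span B s2) [set` T']].
Proof.
move=> DB [DT TF] DN spl [x1 [x1D x10 s1x1 x1s]] [x2 [x2D x20 s2x2 x2s]].
pose x := x1 * x2.
have xD : x \in D by exact: rpredM.
have x0 : x != 0 by exact: mulf_neq0.
have s1x : span B s1 x.
  by rewrite /x mulrC; case: (span_module B s1) => _ _; apply=> //; exact: DB.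
have s2x : span B s2 x by case: (span_module B s2) => _ _; apply=> //; exact: DB.
have xs1 a : a \in s1 -> x * a \in B.
  by move=> as1; rewrite /x mulrAC rpredM ?(DB x2) // x1s //; exact: mem_span.
have xs2 a : a \in s2 -> x * a \in B.
  by move=> as2; rewrite /x -mulrA rpredM ?(DB x1) // x2s //; exact: mem_span.
have [e [f [ef eT fN]]] := spl _ (rpredM xD xD) (mulf_neq0 x0 x0).
pose s := [seq f * a | a <- s1] ++ [seq e * a | a <- s2] ++ [:: x].
have xs : x \in s by rewrite !mem_cat mem_head !orbT.
have fs a : a \in s1 -> f * a \in s.
  by move=> as1; rewrite !mem_cat (map_f (fun a => f * a)).
have es a : a \in s2 -> e * a \in s.
  by move=> as2; rewrite !mem_cat (map_f (fun a => e * a)) ?orbT.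
have sP a : a \in s -> [\/ exists2 b, b \in s1 & a = f * b,
    exists2 b, b \in s2 & a = e * b | a = x].
  rewrite !mem_cat => /or3P[/mapP[b bs ->]|/mapP[b bs ->]|].
  - by constructor 1; exists b.
  - by constructor 2; exists b.
  - by rewrite inE => /eqP->; constructor 3.
exists s; split.
- have eF : e \in frac D.
    rewrite -(divfK (mulf_neq0 x0 x0) e); apply: rpredM; first exact: TF.
    by rewrite sub_frac ?rpredM.
  have fF : f \in frac D by rewrite -(addKr e f) ef rpredD ?rpredN ?rpred1.
  have ext c a : c \in frac D -> x * a \in B ->
      setprod [set` B] [set` frac D] (c * a).
    move=> cF xa; rewrite (_ : c * a = x * a * (c / x)).
      by apply: mem_setprod => //=; rewrite rpredM // frac_inv // sub_frac.
    by rewrite mulrACA [x * c]mulrC -mulrA [x * _]mulrCA divff // mulr1.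
  apply: (commensurable_span DB xD x0 (mem_span B xs)) => a.
  case/sP => [[b /xs1 xb ->]|[b /xs2 xb ->]|->]; try exact: ext.
  by rewrite -[x]mul1r; apply: mem_setprod; rewrite /= ?rpred1 // sub_frac.
- by apply: (glue_at ef x0 (DT x xD) eT s1x xs1 xs2 fs xs sP).
move=> T' NT' T'T.
have fe : f + e = 1 by rewrite addrC.
apply: (glue_at fe x0 (DN T' NT' x xD) (fN T' NT' T'T) s2x xs2 xs1 es xs).
by move=> a /sP[]; [constructor 2|constructor 1|constructor 3].
Qed.

Lemma invertible_fg C I J : submodule C I -> setprod I J = [set` C] ->
  exists2 s, {in s, forall a, I a} & span C s = I.
Proof.
move=> IM IJ; have : setprod I J 1 by rewrite IJ /=; exact: rpred1.
move=> [r rIJ E]; exists [seq p.1 | p <- r].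
  by move=> _ /mapP[p /rIJ[Ip _] ->].
apply/seteqP; split.
  by apply: span_sub => // _ /mapP[p /rIJ[Ip _] ->].
move=> z Iz; rewrite -[z]mul1r E mulr_suml big_seq.
have [M0 MD MC] := span_module C [seq p.1 | p <- r].
elim/big_rec: _ => // p w pr Mw; apply: MD => //.
rewrite -mulrA; apply: mem_setprod; first exact: map_f.
have [_ Jp] := rIJ p pr; rewrite mulrC -IJ.
exact: mem_setprod.
Qed.
End Lifting.

Section Lift.
Variable L : fieldType.
Implicit Types (A B C S T : subring L) (M I J : set L) (s : seq L).
Variables (D : subring L) (Th : set (subring L)) (W : Type) (le : rel W).
Variable lev : subring L -> W.
Hypothesis wo : wochoice.well_order le.
Hypothesis Thf : flat_overrings D Th.
Hypothesis Thc : complete_family D Th.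
Hypothesis cpt : compact [set T : overrings D | Th (sval T)].
Hypothesis lev_splits : forall T, Th T ->
  splits D [set T' | Th T' /\ le (lev T) (lev T')] T.

Lemma local_global_sub M1 M2 : submodule D M1 -> submodule D M2 ->
  (forall T, Th T -> setprod M1 [set` T] `<=` setprod M2 [set` T]) -> M1 `<=` M2.
Proof.
move=> M1M M2M sub z M1z; apply: (local_global Thc (flat_overrings_denominator Thf) M2M).
by move=> T ThT; apply: sub => //; exact: mem_ext.
Qed.

Lemma local_global_eq M1 M2 : submodule D M1 -> submodule D M2 ->
  (forall T, Th T -> setprod M1 [set` T] = setprod M2 [set` T]) -> M1 = M2.
Proof.
move=> M1M M2M E.
by apply/seteqP; split; apply: local_global_sub => // T ThT; rewrite E.
Qed.

Variable B : subring L.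
Hypothesis DB : {subset D <= B}.

Lemma commensurable_ext_frac M : submodule B M -> commensurable D B M ->
  setprod M [set` frac D] = setprod [set` B] [set` frac D].
Proof.
move=> [M0 MD MB] [x [xD x0 Mx xM]].
have xVF : x^-1 \in frac D by rewrite frac_inv // sub_frac.
apply/seteqP; split.
  rewrite -[X in _ `<=` setprod _ X](setprod_sub (A := frac D)) // setprodA.
  apply: setprodS => // z Mz; rewrite -(mulKf x0 z) mulrC.
  by apply: mem_setprod => //; exact: xM.
rewrite -[X in _ `<=` setprod _ X](setprod_sub (A := frac D)) // setprodA.
apply: setprodS => // b bB; rewrite -(mulfK x0 b); apply: mem_setprod => //.
exact: MB.
Qed.

Lemma commensurable_ext T M : overring D T -> submodule B M ->
  commensurable D B M -> commensurable D (compositum B T) (setprod M [set` T]).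
Proof.
move=> [DT _] MM [x [xD x0 Mx xM]]; exists x; split=> //; first exact: mem_ext.
move=> z zM; apply/asboolP.
apply: (@setprod_ind _ _ _ [set z | setprod [set` B] [set` T] (x * z)]) zM => /=.
- by rewrite mulr0; exact: setprod0.
- by move=> u v uP vP; rewrite mulrDr; exact: setprodD.
- by move=> m t Mm tT; rewrite mulrA; apply: mem_setprod => //; exact: xM.
Qed.

(** The ideals are given by finite lists of generators, in order that this is an
    open condition on T. *)
Definition inverse_at (p : seq L * seq L) T : Prop :=
  setprod (setprod (span B p.1) (span B p.2)) [set` T] =
  setprod [set` B] [set` T].

Lemma inverse_atP p T : inverse_at p T <->
  (forall a b, a \in p.1 -> b \in p.2 -> setprod [set` B] [set` T] (a * b)) /\
  setprod (setprod (span B p.1) (span B p.2)) [set` T] 1.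
Proof.
rewrite /inverse_at; split=> [E|[ab one]].
  rewrite E; split=> [a b ap bp|]; last by apply: mem_ext; exact: rpred1.
  by rewrite -E; apply/mem_ext/mem_setprod; exact: mem_span.
have B1 : submodule B (setprod [set` B] [set` T]).
  exact/submoduleM/submodule1.
have T1 M : submodule T (setprod M [set` T]) by exact: submodule_ext.
apply/seteqP; split; apply: setprod_sub_module => //.
  rewrite setprod_ext; apply: setprod_sub_module => //; have [b0 bD _] := B1.
  by apply: setprod_ind => // a b; exact: ab.
move=> b bB; rewrite -[b]mulr1.
have [_ _ bM] : submodule B (setprod (setprod (span B p.1) (span B p.2)) [set` T]).
  exact/submoduleM/submoduleM/span_module.
exact: bM.
Qed.

Lemma mem_ext_open M z : zariski_open (fun T => setprod M [set` T] z).
Proof.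
move=> T [r rM ->]; exists [seq p.2 | p <- r].
  by move=> _ /mapP[p /rM[_ pT] ->].
move=> T' rT'; exists r => // p pr; split; first by case: (rM p pr).
exact/rT'/map_f.
Qed.

Lemma zariski_openI (P Q : subring L -> Prop) :
  zariski_open P -> zariski_open Q -> zariski_open (fun T => P T /\ Q T).
Proof.
move=> Po Qo T [/Po[F FT FP] /Qo[G GT GQ]]; exists (F ++ G).
  by move=> x; rewrite mem_cat => /orP[/FT|/GT].
move=> T' FGT'; split; [apply: FP|apply: GQ] => x xs; apply: FGT'.
  by rewrite mem_cat xs.
by rewrite mem_cat xs orbT.
Qed.

Lemma zariski_open_all (X : eqType) (l : seq X) (P : X -> subring L -> Prop) :
  (forall x, zariski_open (P x)) ->
  zariski_open (fun T => forall x, x \in l -> P x T).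
Proof.
move=> Po; elim: l => [|x l IH] T Tl; first by exists [::].
have [|F FT FP] := zariski_openI (Po x) IH (T := T).
  by split=> [|y yl]; apply: Tl; rewrite inE ?eqxx ?yl ?orbT.
exists F => // T' FT' y; have [Px Pl] := FP T' FT'.
by rewrite inE => /orP[/eqP->|/Pl].
Qed.

Lemma inverse_at_open p : zariski_open (inverse_at p).
Proof.
move=> T /inverse_atP[ab one].
have [|F FT FP] := zariski_openI
   (zariski_open_all (l := [seq a * b | a <- p.1, b <- p.2])
     (@mem_ext_open [set` B]))
   (@mem_ext_open (setprod (span B p.1) (span B p.2)) 1) (T := T).
  by split=> // _ /allpairsP[[a b] [ap bp ->]]; exact: ab.
exists F => // T' FT'; apply/inverse_atP; have [ab' one'] := FP T' FT'.
by split=> // a b ap bp; apply: ab'; apply/allpairsP; exists (a, b).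
Qed.

Lemma inverse_at_ext p p' T :
  setprod (span B p.1) [set` T] = setprod (span B p'.1) [set` T] ->
  setprod (span B p.2) [set` T] = setprod (span B p'.2) [set` T] ->
  inverse_at p' T -> inverse_at p T.
Proof. by rewrite /inverse_at -!setprod_ext => -> ->. Qed.

(** Generators of g and of its inverse h span ideals of B, which are first
    glued with the unit ideal so as to be trivial at the other T' of level at
    least that of T.  These two ideals may fail to be inverse to each other at
    overrings of lower level; there they are replaced by the unit ideal, one
    overring after the other. *)
Lemma lift_invertible T g : Th T -> invertible (compositum B T) g ->
  commensurable D (compositum B T) g ->
  exists I, [/\ invertible B I, commensurable D B I, setprod I [set` T] = g &
    forall T', Th T' -> le (lev T) (lev T') -> T' <> T ->
      setprod I [set` T'] = setprod [set` B] [set` T']].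
Proof.
move=> ThT [[gM gF _] [h [hM hF _] gh]] [x [xD x0 gx xg]].
pose C := compositum B T; have over S : Th S -> overring D S by case/Thf.
have [DT TF] := over T ThT.
have hx : h x.
  rewrite -[x]mulr1; have : setprod g h 1 by rewrite gh /=; exact: rpred1.
  have [h0 hD hC] := hM.
  apply: (@setprod_ind _ _ _ [set z | h (x * z)]) => /=.
  - by rewrite mulr0.
  - by move=> u v hu hv; rewrite mulrDr; exact: hD.
  - by move=> u v gu hv; rewrite mulrA; apply: hC => //; exact: xg.
have xh z : h z -> x * z \in C.
  move=> hz; suff : [set` C] (x * z) by [].
  by rewrite /C -gh; exact: mem_setprod.
have gen I : submodule C I -> I x -> (forall z, I z -> x * z \in C) ->
    (exists2 s, {in s, forall a, I a} & span C s = I) ->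
    exists2 s, commensurable D B (span B s) & setprod (span B s) [set` T] = I.
  move=> IM Ix xI [s sI sE]; exists (x :: s).
    apply: (commensurable_span DB xD x0); first exact/mem_span/mem_head.
    move=> a as_; have Ia : I a.
      by move: as_; rewrite inE => /orP[/eqP->|/sI].
    have [_ _ FM] := submodule_ext [set` B] (frac D).
    rewrite -(mulKf x0 a); apply: FM; first exact/frac_inv/sub_frac.
    have : setprod [set` B] [set` T] (x * a) by rewrite -compositumE; exact: xI.
    by apply: setprodS => // t; exact: TF.
  rewrite /span -setprodA -compositumE; apply/seteqP; split.
    apply: span_sub => // a; by rewrite inE => /orP[/eqP->|/sI].
  by rewrite -sE; apply: setprodS => // a /= as_; rewrite inE as_ orbT.
have [s1 s1c s1E] := gen g gM gx xg (invertible_fg gM gh).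
have [s2 s2c s2E] := gen h hM hx xh (invertible_fg hM (etrans (setprodC _ _) gh)).
have c1 : commensurable D B (span B [:: 1]) by rewrite span1; exact: commensurable1.
pose N S := [set T' | Th T' /\ le (lev S) (lev T')].
have ND S T' : N S T' -> {subset D <= T'} by move=> [/over[]].
have glue1 S s s' (ThS : Th S) sc s'c := glue (s1 := s) (s2 := s') DB
  (over S ThS) (ND S) (lev_splits ThS) sc s'c.
have [t1 [t1c t1E t1N]] := glue1 T s1 [:: 1] ThT s1c c1.
have [t2 [t2c t2E t2N]] := glue1 T s2 [:: 1] ThT s2c c1.
pose Q (p : seq L * seq L) := [/\ commensurable D B (span B p.1),
  commensurable D B (span B p.2),
  setprod (span B p.1) [set` T] = g /\ setprod (span B p.2) [set` T] = h &
  forall T', Th T' -> le (lev T) (lev T') -> T' <> T ->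
    setprod (span B p.1) [set` T'] = setprod [set` B] [set` T'] /\
    setprod (span B p.2) [set` T'] = setprod [set` B] [set` T']].
have BB S : setprod (setprod [set` B] [set` B]) [set` S] = setprod [set` B] [set` S].
  by rewrite setprod_sub.
(* In a state satisfying [Q], a bad overring has lower level than [T]. *)
have Qinv p S : Q p -> Th S -> le (lev T) (lev S) -> inverse_at p S.
  move=> [_ _ [E1 E2] EN] ThS TS; rewrite /inverse_at -setprod_ext.
  have [->|ST] := pselect (S = T); first by rewrite E1 E2 gh compositumE.
  by have [-> ->] := EN S ThS TS ST; rewrite setprod_ext BB.
have [||||[p1 p2] Qp inv] := devissage wo over cpt lev_splits
    (P := inverse_at) (Q := Q) _ _ _ (p := (t1, t2)).
- by move=> p _; exact: inverse_at_open.
- move=> p [c1' c2' _ _]; rewrite /inverse_at -setprod_ext.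
  by rewrite !commensurable_ext_frac ?setprod_ext ?BB //; exact: span_module.
- move=> p S Qp ThS NS; have [pc1 pc2 [E1 E2] EN] := Qp.
  have NTS : ~ le (lev T) (lev S) by move=> /(Qinv p S Qp ThS).
  have ST : le (lev S) (lev T) by case: (wo_total wo (lev S) (lev T)).
  have neT T' : le (lev T) (lev T') -> T' <> S.
    by move=> TT' T'S; rewrite T'S in TT'.
  have [u1 [u1c u1E u1N]] := glue1 S [:: 1] p.1 ThS c1 pc1.
  have [u2 [u2c u2E u2N]] := glue1 S [:: 1] p.2 ThS c1 pc2.
  have rfl c : le c c by case: (wo_total wo c c).
  exists (u1, u2); split.
  + split=> //=.
      by rewrite u1N ?u2N //; exact: neT.
    move=> T' ThT' TT' T'T; have ST' := wo_trans wo ST TT'.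
    by rewrite u1N ?u2N //; [exact: EN|exact: neT|exact: neT].
  + by rewrite /inverse_at -setprod_ext u1E u2E span1 setprod_ext BB.
  + move=> T' ThT' ST' T'S; apply: inverse_at_ext; first exact: u1N.
    exact: u2N.
- split=> //=; first by rewrite t1E t2E.
  by move=> T' ThT' TT' T'T; rewrite t1N ?t2N // span1.
have Dsub s : submodule D (span B s) by apply: submoduleS DB (span_module B s).
have I1I2 : setprod (span B p1) (span B p2) = [set` B].
  apply: local_global_eq => [||S ThS]; first exact: submoduleM.
    exact: submodule_ring.
  exact: inv.
have [pc1 pc2 [E1 E2] EN] := Qp.
have fr s : commensurable D B (span B s) -> fractional B (span B s).
  move=> [y [yD y0 _ yB]]; split; first exact: span_module.
    move=> z sz; rewrite -(mulKf y0 z) /= rpredM //; last exact/sub_frac/yB.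
    exact/frac_inv/sub_frac/DB.
  by exists y; rewrite ?DB.
exists (span B p1); split=> //.
  by split; [exact: fr|exists (span B p2) => //; exact: fr].
by move=> T' ThT' TT' T'T; case: (EN T' ThT' TT' T'T).
Qed.
End Lift.

(** * The group LPic_u as a quotient of Inv_u *)

Section Classes.
Variable L : fieldType.
Implicit Types (A B C D T : subring L) (M : set L).

Lemma principal_module C x : submodule C (principal C x).
Proof.
split=> [|_ _ [a aC <-] [b bC <-]|c _ cC [a aC <-]].
- by exists 0; rewrite /= ?rpred0 ?mulr0.
- by exists (a + b); rewrite ?mulrDr //= rpredD.
- by exists (c * a); rewrite 1?mulrCA //= rpredM.
Qed.

Lemma mem_principal C x : principal C x x.
Proof. by exists 1; rewrite ?mulr1 //= rpred1. Qed.

Lemma invertible_principal C x : x \in frac C -> x != 0 ->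
  invertible C (principal C x).
Proof.
have fr y : y \in frac C -> y != 0 -> fractional C (principal C y).
  move=> /[dup] yF /asboolP[a [b [aC bC b0 yE]]] y0.
  split; first exact: principal_module.
    by move=> _ [c cC <-] /=; rewrite rpredM // sub_frac.
  exists b => // _ [c cC <-]; rewrite mulrA rpredM //.
  by rewrite yE mulrC divfK.
move=> xF x0; split; first exact: fr.
exists (principal C x^-1); first by apply: fr; rewrite ?frac_inv ?invr_eq0.
by rewrite principalM divff // principal1.
Qed.

Definition principal_inv C x (xF : x \in frac C) (x0 : x != 0) : inv_ideal C :=
  InvIdeal (asboolT (invertible_principal xF x0)).

Lemma inv_ideal_module C (I : inv_ideal C) : submodule C (inv_val I).
Proof. by case: (inv_idealP I) => -[]. Qed.

Lemma inv_valN C (I : inv_ideal C) :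
  setprod (inv_val I) (inv_val (- I)) = [set` C].
Proof. by rewrite -inv_valD subrr. Qed.

Lemma commensurableN A C (I : inv_ideal C) :
  commensurable A C (inv_val I) -> commensurable A C (inv_val (- I)).
Proof.
move=> [x [xA x0 Ix xI]]; exists x; split=> // [|z zJ].
  rewrite -[x]mulr1; have : setprod (inv_val I) (inv_val (- I)) 1.
    by rewrite inv_valN /=; exact: rpred1.
  have [J0 JD JC] := inv_ideal_module (- I).
  apply: (@setprod_ind _ _ _ [set z | inv_val (- I) (x * z)]) => /=.
  - by rewrite mulr0.
  - by move=> u v hu hv; rewrite mulrDr; exact: JD.
  - by move=> u v gu hv; rewrite mulrA; apply: JC => //; exact: xI.
suff : [set` C] (x * z) by [].
by rewrite -(inv_valN I); exact: mem_setprod.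
Qed.

Lemma commensurableM A C M N : commensurable A C M -> commensurable A C N ->
  commensurable A C (setprod M N).
Proof.
move=> [x [xA x0 Mx xM]] [y [yA y0 Ny yN]]; exists (x * y).
split; [exact: rpredM|exact: mulf_neq0|exact: mem_setprod|].
apply: (@setprod_ind _ _ _ [set z | x * y * z \in C]) => /=.
- by rewrite mulr0 rpred0.
- by move=> u v; rewrite mulrDr; exact: rpredD.
- by move=> u v Mu Nv; rewrite mulrACA rpredM ?xM ?yN.
Qed.

Lemma commensurable_unitary A C M : {subset A <= C} -> submodule C M ->
  M `<=` [set` C] -> unitary A M -> commensurable A C M.
Proof.
move=> AC [M0 MD MC] MsC Mu.
have [x [Mx x0 /asboolP[a [b [aA bA b0 xE]]]]] :
    exists x, [/\ M x, x != 0 & x \in frac A].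
  apply: contrapT => none; apply: Mu; apply/seteqP; split=> [x [Mx xF]|_ ->].
    by apply: contrapT => /eqP x0; apply: none; exists x.
  by split=> //=; exact: rpred0.
have aE : a = b * x by rewrite xE mulrC divfK.
exists a; split=> //.
- by rewrite aE mulf_neq0.
- by rewrite aE; apply: MC => //; exact: AC.
- by move=> z /MsC zC; rewrite rpredM // AC.
Qed.

Lemma unitary_mem A M x : x \in frac A -> x != 0 -> M x -> unitary A M.
Proof.
move=> xF x0 Mx E; have : [set 0] x by rewrite -E.
by move/eqP; exact/negP.
Qed.

(** From right to left, I = (xI)(xC)^-1 is a quotient of integral unitary ideals. *)
Lemma invu_predP A C (I : inv_ideal C) : {subset A <= C} ->
  I \in @invu_pred L C A <-> commensurable A C (inv_val I).
Proof.
move=> AC; split.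
  move/asboolP/(_ [pred I | `[< commensurable A C (inv_val I) >]]) => H.
  apply/asboolP/H => [|J [[JM JC] Ju]]; last first.
    by apply/asboolP/commensurable_unitary.
  split=> [|J K /asboolP Jc /asboolP Kc]; apply/asboolP.
    exact: commensurable1.
  by rewrite inv_valD; apply: commensurableM => //; exact: commensurableN.
move=> [x [xA x0 Ix xI]].
have xF : x \in frac C by apply/sub_frac/AC.
rewrite -(addrK (principal_inv xF x0) I).
have xF' : x \in frac A by exact: sub_frac.
have P : principal_inv xF x0 \in @invu_pred L C A.
  apply: gensub_sub; split; last exact: unitary_mem xF' x0 (mem_principal _ _).
  split; first exact: principal_module.
  by move=> _ [c cC <-] /=; rewrite rpredM // AC.
apply: rpredB => //; apply: gensub_sub; split; last first.
  apply: (@unitary_mem _ _ (x * x)); rewrite ?rpredM ?mulf_neq0 //.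
  exact/mem_setprod/mem_principal.
split; first exact: inv_ideal_module.
rewrite inv_valD setprodC /=; apply: setprod_ind => [|u v|_ z [c cC <-] Iz] /=.
- exact: rpred0.
- exact: rpredD.
- by rewrite mulrAC rpredM // xI.
Qed.

Definition principal_descent A C : Prop :=
  forall z, z \in frac C -> z != 0 -> commensurable A C (principal C z) ->
    exists x, [/\ x \in frac A, x != 0 & principal C z = principal C x].

(** A multiple b of z by an element of K lies in B and divides, in B, a nonzero
    element of D; so bB is generated by an element of D. *)
Lemma pseudo_descent D B T C : {subset D <= B} -> pseudo_polynomial D B ->
  overring D T -> {subset B <= C} -> {subset T <= C} ->
  (forall c, c \in C -> exists d, [/\ d \in D, d != 0 & d * c \in B]) ->
  principal_descent T C.
Proof.
move=> DB pp [DT TF] BC TC den z _ z0 [x [xT x0 [c cC xE] xz]].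
have xzC : x * z \in C by apply: xz; exact: mem_principal.
have /asboolP[p [q [pD qD q0 xpq]]] := TF x xT.
have [d [dD d0 dxz]] := den _ xzC; have [d' [d'D d'0 d'c]] := den c cC.
pose k := d * x; have k0 : k != 0 by exact: mulf_neq0.
have kT : k \in T by rewrite rpredM // DT.
pose b := k * z; have b0 : b != 0 by exact: mulf_neq0.
have bB : b \in B by rewrite /b /k -mulrA.
have [a aD bE] : exists2 a, a \in D & principal B b = principal B a.
  apply: pp => //; apply: (@unitary_mem _ _ (b * (d' * c))).
  - by rewrite /b mulrACA xE !rpredM ?(TF x) ?sub_frac.
  - by rewrite /b mulrACA xE !mulf_neq0.
  - by exists (d' * c).
have [u uB aub] : principal B a b by rewrite -bE; exact: mem_principal.
have [v vB bva] : principal B b a by rewrite bE; exact: mem_principal.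
have a0 : a != 0 by apply: contraNneq b0 => a0; rewrite -aub a0 mul0r.
exists (a / k); split.
- by rewrite rpredM ?frac_inv ?(sub_frac kT) ?(sub_frac (DT _ _)).
- by rewrite mulf_neq0 // invr_eq0.
have zE : z = a / k * u by rewrite mulrAC aub /b mulrAC divff // mul1r.
have akE : a / k = z * v by rewrite -bva /b mulrAC [k * z]mulrC mulfK.
apply/seteqP; split=> _ [w wC <-].
  by rewrite zE -mulrA; exists (u * w) => //=; rewrite rpredM // BC.
by rewrite akE -mulrA; exists (v * w) => //=; rewrite rpredM // BC.
Qed.

Section Kernel.
Variables (A B : subring L) (AB : {subset A <= B}).

Definition lclass (I : invu B A) : lpicu AB :=
  \pi_(lpicu AB) (\pi_(picu B A) I).

Lemma lclass_zmod : zmod_morphism lclass.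
Proof. by move=> I J; rewrite /lclass !raddfB. Qed.
HB.instance Definition _ := GRing.isZmodMorphism.Build (invu B A) (lpicu AB)
  lclass lclass_zmod.

Lemma lclass_surj q : exists I, lclass I = q.
Proof. by exists (repr (repr q)); rewrite /lclass !reprK. Qed.

Lemma commensurable_extended (J : inv_ideal A) :
  commensurable A B (setprod (inv_val J) [set` B]).
Proof.
have [[[J0 JD JA] JF [b [bA b0] bJ]] [K [KM _ _] JK]] := inv_idealP J.
have [y [Jy y0]] : exists y, inv_val J y /\ y != 0.
  apply: contrapT => none; have /eqP[] := oner_neq0 L.
  have : setprod (inv_val J) K 1 by rewrite JK /=; exact: rpred1.
  apply: (@setprod_ind _ _ _ [set z | z = 0]) => //= [u v -> ->|u v Ju _].
    by rewrite addr0.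
  have -> : u = 0 by apply: contrapT => /eqP u0; apply: none; exists u.
  by rewrite mul0r.
exists (b * (b * y)); split.
- by rewrite rpredM // bJ.
- by rewrite !mulf_neq0.
- by apply/mem_ext/(JA b _ bA)/(JA b y bA Jy).
apply: (@setprod_ind _ _ _ [set z | b * (b * y) * z \in B]) => /=.
- by rewrite mulr0 rpred0.
- by move=> u v; rewrite mulrDr; exact: rpredD.
- move=> u v Ju vB; rewrite mulrA [b * _ * u]mulrAC.
  by rewrite rpredM // rpredM // AB // bJ.
Qed.

(** A class vanishes when I is z times an ideal extended from A; the factor z
    can be absorbed in that ideal, as it can be taken in the quotient field
    of A. *)
Lemma lclass_eq0 (I : invu B A) : principal_descent A B ->
  lclass I = 0 <->
  exists2 J, invertible A J & inv_val (val I) = setprod J [set` B].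
Proof.
move=> pd; rewrite /lclass; split.
  move/eqP; rewrite -(raddf0 (\pi_(lpicu AB))) -Quotient.idealrBE subr0.
  move=> /asboolP[c]; rewrite picu_inclE -[c]reprK pic_extE => /eqP.
  rewrite -Quotient.idealrBE => /asboolP[z [zF z0 zE]].
  set J := repr c in zE.
  have IE : val I = (val I - inv_ext AB J) + inv_ext AB J by rewrite subrK.
  have [|x [xF x0 zx]] := pd z zF z0.
    rewrite -zE inv_valD; apply: commensurableM.
      by apply/invu_predP => //; exact: valP.
    by apply/commensurableN/commensurable_extended.
  exists (setprod (principal A x) (inv_val J)).
    by apply: invertibleM; [exact: invertible_principal|exact: inv_idealP].
  rewrite {1}IE inv_valD zE zx /=.
  have -> : principal B x = setprod (principal A x) [set` B].
    apply/seteqP; split=> [_ [a aB <-]|].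
      by apply: mem_setprod => //; exact: mem_principal.
    apply: setprod_sub_module; first exact: principal_module.
    by move=> _ [a aA <-]; exists a => //=; exact: AB.
  by rewrite setprod_ext.
move=> [J Ji IE]; apply/eqP.
rewrite -(raddf0 (\pi_(lpicu AB))) -Quotient.idealrBE subr0; apply/asboolP.
exists (\pi_(pic A) (InvIdeal (asboolT Ji))).
by rewrite picu_inclE pic_extE; congr (\pi_(pic B) _); apply: val_inj.
Qed.
End Kernel.
End Classes.

(** * Free groups and direct sums *)

Lemma zmod_iso_sym (V W : zmodType) : zmod_iso V W -> zmod_iso W V.
Proof.
move=> [f [g fK gK]].
have g_zmod : zmod_morphism g by exact: can2_zmod_morphism fK gK.
pose g' : {additive W -> V} := HB.pack g (GRing.isZmodMorphism.Build W V g g_zmod).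
by exists g'; exists f.
Qed.

Lemma bijective_inj_surj (X Y : Type) (f : X -> Y) :
  injective f -> (forall y, exists x, f x = y) -> bijective f.
Proof.
move=> finj /choice[g gK]; exists g => // x.
by apply: finj; rewrite gK.
Qed.

(** A surjection onto a free abelian group splits; here the splitting is to take
    its values in a subgroup [P] which already maps onto [V]. *)
Lemma free_lift (V G : zmodType) (P : zmodClosed G) (f : {additive G -> V}) :
  free_abelian V -> (forall v, exists2 g, g \in P & f g = v) ->
  exists s : {additive V -> G}, forall v, s v \in P /\ f (s v) = v.
Proof.
move=> [X [phi [psi phiK psiK]]] surj.
have psi_zmod : zmod_morphism psi by exact: can2_zmod_morphism phiK psiK.
have /choice[h hP] (x : X) : exists g, g \in P /\ f g = phi << x >>.
  by have [g gP fg] := surj (phi << x >>); exists g.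
pose sig (z : {freeg X / int}) : G := fglift (fun x => h x : zmodule G) z.
have sigB : zmod_morphism sig by exact: (@lift_is_additive int _ (zmodule G)).
have sigU (k : int) x : sig << k *g x >> = h x *~ k by rewrite /sig liftU.
pose sig' : {additive {freeg X / int} -> G} :=
  HB.pack sig (GRing.isZmodMorphism.Build {freeg X / int} G sig sigB).
have sigP z : sig' z \in P /\ f (sig' z) = phi z.
  elim/freeg_ind_dom0: z => [|k x z _ _ [zP fz]].
    by rewrite !raddf0 rpred0.
  have [hxP fhx] := hP x; split.
    by rewrite raddfD rpredD //= sigU rpredMz.
  rewrite !raddfD /= fz; congr (_ + _); rewrite sigU raddfMz fhx -raddfMz.
  by rewrite freegU_mulz intz.
have s_zmod : zmod_morphism (sig' \o psi).
  by move=> u v; rewrite /= psi_zmod -[LHS]/(sig' _) raddfB.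
pose s : {additive V -> G} :=
  HB.pack (sig' \o psi) (GRing.isZmodMorphism.Build V G (sig' \o psi) s_zmod).
by exists s => v; have [sP fs] := sigP (psi v); split; rewrite ?fs ?psiK.
Qed.

Section DirectSumMap.
Variables (I : choiceType) (M : I -> zmodType) (V : zmodType).
Variable s : forall i, {additive M i -> V}.

Definition dsum_map (f : dsum M) : V := \sum_(i \in [set: I]) s i (dsum_val f i).

Lemma dsum_mapE (f : dsum M) (l : seq I) : uniq l ->
  (forall i, dsum_val f i != 0 -> i \in l) ->
  dsum_map f = \sum_(i <- l) s i (dsum_val f i).
Proof.
move=> ul fl; rewrite /dsum_map (fsbigE l) //.
  by apply: eq_bigl => i; rewrite in_setT.
move=> i _ il; have [->|/fl il'] := eqVneq (dsum_val f i) 0; first exact: raddf0.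
by rewrite il' in il.
Qed.

Lemma dsum_support (f : dsum M) :
  exists2 l : seq I, uniq l & forall i, dsum_val f i != 0 -> i \in l.
Proof.
case: f => f /= /asboolP/finite_seqP[l lE]; exists (undup l).
  exact: undup_uniq.
by move=> i fi; rewrite mem_undup; have : [set i | f i != 0] i by []; rewrite lE.
Qed.

Lemma dsum_map_zmod : zmod_morphism dsum_map.
Proof.
move=> f g; have [l ul fl] := dsum_support f; have [k uk gk] := dsum_support g.
pose m := undup (l ++ k); have um : uniq m by exact: undup_uniq.
have fm i : dsum_val f i != 0 -> i \in m.
  by move=> /fl il; rewrite mem_undup mem_cat il.
have gm i : dsum_val g i != 0 -> i \in m.
  by move=> /gk ik; rewrite mem_undup mem_cat ik orbT.
have fgm i : dsum_val (f - g) i != 0 -> i \in m.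
  have [f0|/fm//] := eqVneq (dsum_val f i) 0.
  have [g0|/gm//] := eqVneq (dsum_val g i) 0.
  by rewrite /= f0 g0 subrr eqxx.
rewrite !(dsum_mapE um) // -sumrB; apply: eq_bigr => i _.
by rewrite -raddfB.
Qed.
HB.instance Definition _ := GRing.isZmodMorphism.Build (dsum M) V dsum_map
  dsum_map_zmod.

Lemma dfwith_finsupp i (m : M i) : finsupp (dfwith (fun j => 0 : M j) i m).
Proof.
apply/asboolP; apply: (sub_finite_set _ (finite_set1 i)) => j /=.
by apply: contraNP => ji; rewrite dfwithout //; apply/eqP => ij; case: ji.
Qed.
Definition dsum_single i (m : M i) : dsum M := Dsum (dfwith_finsupp m).

Lemma dsum_map_single i (m : M i) : dsum_map (dsum_single m) = s i m.
Proof.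
rewrite (@dsum_mapE _ [:: i]) //; first by rewrite big_seq1 /= dfwithin.
by move=> j /=; apply: contraNT; rewrite inE => ji; rewrite dfwithout // eq_sym.
Qed.
End DirectSumMap.

(** * The direct sum decomposition *)

Section Restriction.
Variable L : fieldType.
Implicit Types (A B C D T : subring L) (M : set L).

Lemma sub_composituml B T : {subset B <= compositum B T}.
Proof.
move=> b bB; apply/asboolP; rewrite -[b]mulr1.
by apply: mem_setprod; rewrite //= rpred1.
Qed.

Lemma compositum_overring D T : {subset D <= T} -> compositum D T = T.
Proof.
move=> DT; apply: subring_anti => x; last exact: sub_compositumr.
by move/asboolP; rewrite setprod_sub.
Qed.

Lemma ext_compositum B T M : submodule B M ->
  setprod M [set` compositum B T] = setprod M [set` T].
Proof. by move=> MM; rewrite compositumE setprodA [setprod M _]setprodC setprod1. Qed.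

Lemma commensurableS D T C M : {subset D <= T} -> commensurable D C M ->
  commensurable T C M.
Proof. by move=> DT [x [xD x0 Mx xM]]; exists x; split=> //; exact: DT. Qed.

Lemma commensurable_overring D T C M : overring D T -> {subset T <= C} ->
  submodule C M -> commensurable T C M -> commensurable D C M.
Proof.
move=> [DT TF] TC [M0 MD MC] [x [xT x0 Mx xM]].
have /asboolP[a [b [aD bD b0 xE]]] := TF x xT.
have aE : a = b * x by rewrite xE mulrC divfK.
exists a; split=> //; rewrite aE; first by rewrite mulf_neq0.
  by apply: MC => //; apply/TC/DT.
by move=> z /xM xz; rewrite -mulrA rpredM // TC // DT.
Qed.

Variables (D B : subring L) (DB : {subset D <= B}).

Section OneOverring.
Variables (T : subring L) (To : overring D T).
Local Notation C := (compositum B T).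

Lemma restrict_subproof (I : invu B D) :
  inv_ext (@sub_composituml B T) (val I) \in @invu_pred L C T.
Proof.
apply/invu_predP; first exact: sub_compositumr.
rewrite /= ext_compositum; last exact: inv_ideal_module.
apply: (commensurableS To.1); apply: commensurable_ext => //.
  exact: inv_ideal_module.
by apply/invu_predP => //; exact: valP.
Qed.

Definition restrict (I : invu B D) : invu C T :=
  exist _ (inv_ext (@sub_composituml B T) (val I)) (restrict_subproof I).

Lemma restrict_zmod : zmod_morphism restrict.
Proof. by move=> I J; apply: val_inj; rewrite /= raddfB. Qed.
HB.instance Definition _ := GRing.isZmodMorphism.Build (invu B D) (invu C T)
  restrict restrict_zmod.

Lemma restrict_val (I : invu B D) :
  inv_val (val (restrict I)) = setprod (inv_val (val I)) [set` T].
Proof. by rewrite /= ext_compositum //; exact: inv_ideal_module. Qed.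

Lemma restrict_eq0 (I : invu B D) : restrict I = 0 <->
  setprod (inv_val (val I)) [set` T] = setprod [set` B] [set` T].
Proof.
rewrite -restrict_val -compositumE -inv_val0; split=> [->//|E].
by apply/val_inj/val_inj.
Qed.
End OneOverring.

Lemma extended_subproof (J : inv_ideal D) : inv_ext DB J \in @invu_pred L B D.
Proof. by apply/invu_predP => //; exact: commensurable_extended. Qed.

Definition extended (J : inv_ideal D) : invu B D :=
  exist _ (inv_ext DB J) (extended_subproof J).

(** Testing only the membership of 1 shows that triviality at T is an open
    condition, without reference to generators. *)
Lemma trivial_extP (I : inv_ideal B) T :
  setprod (inv_val I) [set` T] = setprod [set` B] [set` T] <->
  setprod (inv_val I) [set` T] 1 /\ setprod (inv_val (- I)) [set` T] 1.
Proof.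
have IN : setprod (setprod (inv_val I) [set` T]) (setprod (inv_val (- I)) [set` T])
    = setprod [set` B] [set` T] by rewrite setprod_ext inv_valN.
have B1 : setprod [set` B] [set` T] 1 by apply: mem_ext; exact: rpred1.
have up (H : inv_ideal B) : setprod (inv_val H) [set` T] 1 ->
    setprod [set` B] [set` T] `<=` setprod (inv_val H) [set` T].
  move=> H1; apply: setprod_sub_module; first exact: submodule_ext.
  move=> b bB; rewrite -[b]mulr1.
  have [_ _ HB] := submoduleM [set` T] (inv_ideal_module H).
  exact: HB.
have BI (H : inv_ideal B) : setprod (setprod (inv_val H) [set` T])
    (setprod [set` B] [set` T]) = setprod (inv_val H) [set` T].
  rewrite setprod_ext [setprod (inv_val H) _]setprodC setprod1 //.
  exact: inv_ideal_module.
split=> [E|[I1 N1]]; last first.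
  apply/seteqP; split; last exact: up.
  by rewrite -BI -[X in _ `<=` X]IN; apply: setprodS => //; exact: up.
split; first by rewrite E.
by rewrite -BI -E setprodC IN.
Qed.
End Restriction.

Section Decomposition.
Variable L : fieldType.
Implicit Types (T : subring L).
Variables (D B : subring L) (DB : {subset D <= B}).
Variables (Th : set (subring L)) (W : Type) (le : rel W).
Variable lev : subring L -> W.
Hypothesis pp : pseudo_polynomial D B.
Hypothesis wo : wochoice.well_order le.
Hypothesis Thf : flat_overrings D Th.
Hypothesis Thc : complete_family D Th.
Hypothesis cpt : compact [set T : overrings D | Th (sval T)].
Hypothesis lev_splits : forall T, Th T ->
  splits D [set T' | Th T' /\ le (lev T) (lev T')] T.

Let Ix : choiceType := {classic {T : subring L | Th T}}.
Let ov (i : Ix) : overring D (sval i) := (Thf (svalP i)).1.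
Let Q (i : Ix) : zmodType := lpicu (@sub_compositumr _ B (sval i)).
Let rho (i : Ix) : {additive invu B D -> invu (compositum B (sval i)) (sval i)} :=
  restrict DB (ov i).
Let cl (i : Ix) : {additive invu (compositum B (sval i)) (sval i) -> Q i} :=
  lclass (@sub_compositumr _ B (sval i)).

Lemma descent_compositum T : Th T -> principal_descent T (compositum B T).
Proof.
move=> ThT; have [To _] := Thf ThT.
apply: (pseudo_descent DB pp To).
- exact: sub_composituml.
- exact: sub_compositumr.
move=> c /asboolP cBT; apply: denominator_ext => //.
by apply: setprodS cBT => // t; exact: To.2.
Qed.

Lemma descent_base : principal_descent D B.
Proof.
apply: (pseudo_descent DB pp (T := D)) => //; first by split=> //; exact: sub_frac.
by move=> c cB; exists 1; rewrite rpred1 oner_eq0 mul1r.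
Qed.

Definition above (i k : Ix) : Prop := le (lev (sval i)) (lev (sval k)) /\ k <> i.

Definition above0_pred (i : Ix) : {pred invu B D} :=
  [pred I | `[< forall k, above i k -> rho k I = 0 >]].
Lemma above0_closed i : zmod_closed (above0_pred i).
Proof.
split=> [|I J /asboolP I0 /asboolP J0]; apply/asboolP => k ik.
  exact: raddf0.
by rewrite raddfB I0 ?J0 ?subrr.
Qed.
HB.instance Definition _ i :=
  GRing.isZmodClosed.Build (invu B D) (above0_pred i) (above0_closed i).

Lemma sval_neq (i k : Ix) : k <> i -> sval k <> sval i.
Proof.
move=> ki E; apply: ki; apply: eq_sig_hprop => // T; exact: Prop_irrelevance.
Qed.

Lemma lift_above (i : Ix) (g : invu (compositum B (sval i)) (sval i)) :
  exists2 I, I \in above0_pred i & rho i I = g.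
Proof.
have ThT := svalP i.
have gc : commensurable D (compositum B (sval i)) (inv_val (val g)).
  apply: (commensurable_overring (ov i)); first exact: sub_compositumr.
    exact: inv_ideal_module.
  by apply/invu_predP; [exact: sub_compositumr|exact: valP].
have [I [Ii Ic IE IN]] := lift_invertible wo Thf Thc cpt lev_splits DB ThT
  (inv_idealP (val g)) gc.
have Iu : InvIdeal (asboolT Ii) \in @invu_pred L B D by apply/invu_predP.
exists (exist _ (InvIdeal (asboolT Ii)) Iu).
  apply/asboolP => k [ik ki]; apply/restrict_eq0; apply: IN => //.
    exact: svalP k.
  exact: sval_neq.
apply: val_inj; apply: val_inj; transitivity (setprod I [set` sval i]).
  exact: (restrict_val DB (ov i)).
exact: IE.
Qed.

(** The case B = D of [lift_invertible]: it lifts the ideals of T by which a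
    class may be changed without altering it in LPic_u(RT, T). *)
Lemma lift_base_above (i : Ix) (J : set L) : invertible (sval i) J ->
  exists2 K : inv_ideal D, setprod (inv_val K) [set` sval i] = J &
    extended DB K \in above0_pred i.
Proof.
move=> Ji; have ThT := svalP i; have DT := (ov i).1.
have JM : submodule (sval i) J by case: Ji => -[].
have Jc : commensurable D (sval i) J.
  apply: (commensurable_overring (ov i)) => //.
  have := commensurable_extended (fun x => id) (InvIdeal (asboolT Ji)).
  by rewrite /= setprodC setprod1.
have [|||K [Ki Kc KE KN]] := lift_invertible wo Thf Thc cpt lev_splits
    (B := D) (fun x => id) (T := sval i) (g := J); rewrite ?compositum_overring //.
exists (InvIdeal (asboolT Ki)) => //; apply/asboolP => k [ik ki].
apply/restrict_eq0; rewrite /= -setprodA (setprodC [set` B]) setprodA.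
rewrite KN //; [|exact: svalP k|exact: sval_neq].
by rewrite setprod_sub ?(setprodC [set` sval k]) //; exact: (ov k).1.
Qed.

Hypothesis Qfree : forall i, free_abelian (Q i).

(** Freeness enters only here: the lifts of [lift_above] can be chosen in such a
    way that they depend additively on the class. *)
Lemma section_ex : exists s : forall i : Ix, {additive Q i -> invu B D},
  forall i q, s i q \in above0_pred i /\ cl i (rho i (s i q)) = q.
Proof.
have s_ex (i : Ix) : exists s : {additive Q i -> invu B D},
    forall q, s q \in above0_pred i /\ cl i (rho i (s q)) = q.
  have clrho_zmod : zmod_morphism (cl i \o rho i) by move=> I J /=; rewrite !raddfB.
  pose f : {additive invu B D -> Q i} := HB.pack (cl i \o rho i)
    (GRing.isZmodMorphism.Build _ _ (cl i \o rho i) clrho_zmod).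
  apply: (@free_lift _ _ (above0_pred i) f (Qfree i)) => q.
  have [g <-] := lclass_surj (q : lpicu _).
  by have [I Ii <-] := lift_above g; exists I.
exists (fun i => sval (cid (s_ex i))) => i; exact: svalP (cid (s_ex i)).
Qed.

(** The map from the direct sum is built from the sections of [section_ex].  Its
    injectivity is read off at a nonzero coordinate of highest level, and its
    surjectivity is obtained by [devissage]. *)
Lemma decomposition : zmod_iso (lpicu DB)
  (dsum (fun i : {T : subring L | Th T} => lpicu (@sub_compositumr _ B (sval i)))).
Proof.
apply: zmod_iso_sym.
have [s sP] := section_ex.
have cs_zmod i : zmod_morphism (lclass DB \o s i) by move=> u v /=; rewrite !raddfB.
pose cs i : {additive Q i -> lpicu DB} := HB.pack (lclass DB \o s i)
  (GRing.isZmodMorphism.Build _ _ (lclass DB \o s i) (cs_zmod i)).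
pose Phi : {additive dsum Q -> lpicu DB} := dsum_map cs.
suff : bijective Phi by exists Phi.
have cl_base (J : inv_ideal D) : lclass DB (extended DB J) = 0.
  apply: (lclass_eq0 DB (extended DB J) descent_base).2.
  by exists (inv_val J) => //; exact: inv_idealP.
have cl_rho (i : Ix) I : lclass DB I = 0 -> cl i (rho i I) = 0.
  move=> /(lclass_eq0 DB I descent_base).1[J Ji JE].
  apply: (lclass_eq0 _ (rho i I) (descent_compositum (svalP i))).2.
  exists (setprod J [set` sval i]).
    exact: (invertible_ext (ov i).1 Ji).
  by rewrite (restrict_val DB (ov i)) JE compositumE setprod_ext.
have cl_above (i k : Ix) q : above i k -> rho k (s i q) = 0.
  by move=> ik; have [/asboolP/(_ k ik)] := sP i q.
apply: bijective_inj_surj => [|y].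
  apply: raddf_inj => f Phif.
  apply: contrapT => f0.
  have [i fi] : exists i, dsum_val f i != 0.
    apply: contrapT => none; apply: f0; apply: val_inj.
    apply: functional_extensionality_dep => i /=.
    by apply: contrapT => /eqP fi; apply: none; exists i.
  have [l ul fl] := dsum_support f.
  have [||_ [[t [<- ft]] _ tmax]] := exists_top lev wo
      (B := [set T | exists i : Ix, sval i = T /\ dsum_val f i != 0])
      (l := [seq sval i | i : Ix <- l]) (T0 := sval i).
  - by exists i.
  - exact/map_f/fl.
  have : lclass DB (\sum_(k <- l) s k (dsum_val f k)) = 0.
    rewrite raddf_sum; transitivity (Phi f); last exact: Phif.
    exact/esym/(dsum_mapE cs ul fl).
  move/(cl_rho t); rewrite !raddf_sum (bigD1_seq t) ?fl //=.
  have [_ ->] := sP t (dsum_val f t); rewrite big1_seq ?addr0.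
    by move=> E; rewrite E eqxx in ft.
  move=> k /andP[kt kl]; have [->|fk] := eqVneq (dsum_val f k) 0.
    by rewrite !raddf0.
  rewrite cl_above ?raddf0 //; split; last by move=> E; rewrite E eqxx in kt.
  by apply: tmax; [exists k|exact: map_f].
have [I0 <-] := lclass_surj y.
pose P (I : invu B D) T := setprod (inv_val (val I)) [set` T] =
     setprod [set` B] [set` T].
have Prho (i : Ix) I : rho i I = 0 <-> P I (sval i) by exact: restrict_eq0.
(* The state is an ideal whose class differs from that of [I0] by an element of
   the image; it is to be made trivial at every [T]. *)
have [||||I [f ->] I0'] := devissage wo (fun T ThT => (Thf ThT).1) cpt lev_splits
  (P := P) (Q := fun I => exists f, lclass DB I0 = lclass DB I + Phi f)
  _ _ _ (p := I0).
- move=> I _ T /trivial_extP IT.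
  have [F FT FP] := zariski_openI
    (@mem_ext_open _ (inv_val (val I)) 1) (@mem_ext_open _ (inv_val (- val I)) 1) IT.
  by exists F => // T' /FP IT'; apply/trivial_extP.
- move=> I _; apply: commensurable_ext_frac => //; first exact: inv_ideal_module.
  by apply/invu_predP => //; exact: valP.
- move=> I T [f If] ThT _; pose i : Ix := exist _ T ThT.
  pose q := cl i (rho i I).
  have [sq clsq] := sP i q.
  have : cl i (rho i (I - s i q)) = 0 by rewrite !raddfB clsq subrr.
  move=> /(lclass_eq0 _ _ (descent_compositum (svalP i))).1[J Ji JE].
  have [K KE Ka] := lift_base_above Ji.
  exists (I - s i q - extended DB K); split.
  + exists (f + dsum_single q); rewrite If.
    have -> : Phi (f + dsum_single q) = Phi f + lclass DB (s i q).
      by rewrite raddfD; congr (_ + _); exact: (dsum_map_single cs q).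
    rewrite 2!raddfB [X in _ - X + _](cl_base K) subr0.
    by rewrite [X in _ = _ + X]addrC addrA subrK.
  + apply/(Prho i); rewrite raddfB; apply/eqP; rewrite subr_eq0; apply/eqP.
    apply: val_inj; apply: val_inj; transitivity (setprod J [set` compositum B T]).
      exact: JE.
    rewrite [RHS](restrict_val DB (ov i)) /= -KE compositumE.
    by rewrite setprod_ext.
  + move=> T' ThT' TT' T'T; pose k : Ix := exist _ T' ThT'.
    have ik : above i k by split=> // ki; apply: T'T; rewrite -[T']/(sval k) ki.
    move=> /(Prho k) Ik; apply/(Prho k).
    have /asboolP/(_ k ik) Kk := Ka.
    by rewrite !raddfB Ik Kk cl_above // !subr0.
- by exists 0; rewrite raddf0 addr0.
exists f.
suff -> : I = 0 by rewrite raddf0 add0r.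
apply: val_inj; apply: val_inj.
apply: (local_global_eq Thf Thc).
- exact: (submoduleS DB (inv_ideal_module (val I))).
- exact: submodule_ring.
- exact: I0'.
Qed.
End Decomposition.

Theorem corollary8p5 (D R : idomainType) (j : {rmorphism D -> R})
    (Theta : set (subring {fraction R})) :
  (exists d : D, d != 0 /\ d \isn't a GRing.unit) ->
  retract_algebra j ->
  pseudo_polynomial (base_in_frac j) (ring_in_frac R) ->
  pre_jaffard_family (base_in_frac j) Theta ->
  sharp (base_in_frac j) Theta ->
  (forall T, Theta T ->
    free_abelian (lpicu (@sub_compositumr _ (ring_in_frac R) T))) ->
  zmod_iso (lpicu (@base_sub_ring D R j))
    (dsum (fun T : {T : subring {fraction R} | Theta T} =>
      lpicu (@sub_compositumr _ (ring_in_frac R) (sval T)))).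
Proof.
move=> _ _ pp ThJ sh Qfree.
have [W [le [lev [wo levP]]]] := sharp_levels ThJ sh.
have [Thf Thc _ cpt _] := ThJ.
apply: (decomposition _ pp wo Thf Thc cpt levP) => i.
exact/Qfree/svalP.
Qed.
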